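(* Let $A$ be an irreducible good groupoid atlas and let $x\in X_A$. Let $\mathcal G(A)=\operatorname{colim}_{\alpha\in\phi_A}\mathcal G_\alpha$ be the colimit, in the category of groupoids, of the diagram formed by the local groupoids $\mathcal G_\alpha$ ($\alpha\in\phi_A$) and the structural functors $\phi_\alpha^\beta:\mathcal G_\alpha\to\mathcal G_\beta$ ($\alpha\leqslant\beta$). Then the fundamental group $\pi_1(A,x)$ of the atlas is isomorphic to the fundamental group $\pi_1(\mathcal G(A),x)$ of the groupoid $\mathcal G(A)$ at $x$, i.e. to the vertex group $\mathrm{Hom}_{\mathcal G(A)}(x,x)$.
   Context: A groupoid atlas $A=(X_A,\phi_A,\mathcal G_A)$ consists of a set $X_A$, an index set $\phi_A$ with a reflexive relation $\leqslant$, and for each $\alpha\in\phi_A$ a groupoid $\mathcal G_\alpha$ (a local groupoid) with object set $X_\alpha\subset X_A$, such that if $\alpha\leqslant\beta$ then $X_\alpha\cap X_\beta$ is a union of connected components of $\mathcal G_\alpha$ and a functor $\phi_\alpha^\beta:\mathcal G_\alpha|_{X_\alpha\cap X_\beta}\to\mathcal G_\beta|_{X_\alpha\cap X_\beta}$ which is the identity on objects is given ($\mathcal G|_X$ is the full subgroupoid on $X$); $\phi_\alpha^\alpha=\mathrm{id}$ and $\phi_\beta^\gamma\circ\phi_\alpha^\beta=\phi_\alpha^\gamma$ whenever defined. All atlases are assumed covered: $X_A=\bigcup_\alpha X_\alpha$. $A$ is irreducible if every $\mathcal G_\alpha$ is connected (then $X_\alpha\subset X_\beta$ for $\alpha\leqslant\beta$,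 and $\phi_\alpha^\beta$ is defined on all of $\mathcal G_\alpha$). $A$ is good if for each $x\in X_A$ the set $\phi_x=\{\alpha\in\phi_A : x\in X_\alpha\}$ has an initial element $\alpha_x$ ($\alpha_x\leqslant\beta$ for all $\beta\in\phi_x$). For $A$ good and irreducible, the object set of $\mathcal G(A)$ is $X_A$. A morphism $f:A\to B$ is a triple $(X_f,\phi_f,\mathcal G_f)$ with $X_f:X_A\to X_B$ a function, $\phi_f:\phi_A\to\phi_B$ a function preserving $\leqslant$, and functors $\mathcal G_f(\alpha):\mathcal G_\alpha\to\mathcal G_{\phi_f(\alpha)}$ which are $X_f|_{X_\alpha}$ on objects and commute with the structural functors. For $f,f':A\to B$, $f\lhd f'$ ($f$ is a corestriction of $f'$) means that $\phi_f(\alpha)\leqslant\phi_{f'}(\alpha)$ and $\phi_{\phi_f(\alpha)}^{\phi_{f'}(\alpha)}\circ\mathcal G_f(\alpha)=\mathcal G_{f'}(\alpha)$ for all $\alpha$; $\sim$ is the equivalence relation generated by $\lhd$, and $[f]$ is the class of $f$. The product $A\times B$ has underlying set $X_A\times X_B$, index set $\phi_A\times\phi_B$ with the product relation, and local groupoids $\mathcal G_\alpha\times\mathcal G_\beta$. The line $L$ is the atlas with $X_L=\mathbb Z$, index set the subsets $\{n\}$ and $\{n,n+1\}$ of $\mathbb Z$ ordered by inclusion, and $\mathcal G_s$ the groupoid with object set $s$ and exactly one arrow between any two objects; structural functors are inclusions. For $\lambda:L\to A$ let $\lambda_n$ be the local arrow $\mathcal G_\lambda(\{n,n+1\})(n\to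 n+1)$ of $\mathcal G_{\phi_\lambda(\{n,n+1\})}$. $\lambda$ stabilizes to the left (right) if there are $x\in X_A$, $\alpha\in\phi_A$ with $\lambda_n=\mathrm{id}_x\in\mathcal G_\alpha$ for all small (big) enough $n$. A curve is a class $[\lambda]$ of a morphism $\lambda:L\to A$; a path is a curve $l$ which stabilizes in both directions, i.e. which to each side has a representative stabilizing to that side (equivalently, for good $A$, it has a representative stabilizing in both directions); a loop at $x$ is a path whose eventual values to the left and to the right are both $x$. A homotopy between paths $l,l'$ is a morphism $H:L\times L\to A$ for which there are integers $N_0,N_1,M_0,M_1$ and $\alpha_0,\alpha_1\in\phi_A$ such that $[H\circ j_{N_0}]=l$, $[H\circ j_{N_1}]=l'$, where $j_N:L\to L\times L$ is the inclusion $n\mapsto(n,N)$, $s\mapsto(s,\{N\})$ of the $N$-th row, and for every local arrow $f$ of $L\times L$, $\mathcal G_H(f)=\mathrm{id}_{x_0}\in\mathcal G_{\alpha_0}$ if the first coordinate of the source of $f$ is less than $M_0$, and $\mathcal G_H(f)=\mathrm{id}_{x_1}\in\mathcal G_{\alpha_1}$ if the first coordinate of the target of $f$ is greater than $M_1$ (where $x_0,x_1$ are the endpoints). For a good atlas $A$, $\pi_1(A,x)$ is the set of homotopy classes of loops at $x$ with multiplication induced by concatenation of paths. *)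

(* Defs.v *)
From HB Require Import structures.
From mathcomp Require Import all_boot ssralg ssrnum ssrint order monoid.
From mathcomp Require Import boolp classical_sets.
From Stdlib Require Import Relation_Operators.

Set Implicit Arguments.
Unset Strict Implicit.
Unset Printing Implicit Defensive.

Import Order.TTheory GRing.Theory Num.Theory.
Local Open Scope classical_set_scope.
Local Open Scope ring_scope.

Definition elt (T : Type) (A : set T) (x : T) (Ax : A x) : A :=
  SigSub (mem_set Ax).

Lemma eltP (T : Type) (A : set T) (o : A) : A (val o).
Proof. exact: set_mem (valP o). Qed.

(* The set of classes of R; it is the usual quotient when R is an equivalence. *)
Definition quotient (T : Type) (R : T -> T -> Prop) : Type :=
  range (fun t : T => [set u | R t u]).

Definition cls (T : Type) (R : T -> T -> Prop) (t : T) : quotient R :=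
  elt (imageT (fun t : T => [set u | R t u]) t).

(* Groupoids with object set O, presented by a single set of arrows.
   Composition is written in diagrammatic order: [gcomp f g _] is f then g. *)
Record groupoid (O : Type) := Groupoid {
  arr : Type;
  src : arr -> O;
  tgt : arr -> O;
  idn : O -> arr;
  ginv : arr -> arr;
  gcomp : forall f g : arr, tgt f = src g -> arr;
  src_idn : forall o, src (idn o) = o;
  tgt_idn : forall o, tgt (idn o) = o;
  src_inv : forall f, src (ginv f) = tgt f;
  tgt_inv : forall f, tgt (ginv f) = src f;
  src_comp : forall f g (e : tgt f = src g), src (gcomp e) = src f;
  tgt_comp : forall f g (e : tgt f = src g), tgt (gcomp e) = tgt g;
  comp_idl : forall f (e : tgt (idn (src f)) = src f), gcomp e = f;
  comp_idr : forall f (e : tgt f = src (idn (tgt f))), gcomp e = f;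
  comp_invl : forall f (e : tgt (ginv f) = src f), gcomp e = idn (tgt f);
  comp_invr : forall f (e : tgt f = src (ginv f)), gcomp e = idn (src f);
  compA : forall f g h (fg : tgt f = src g) (gh : tgt g = src h)
    (fg_h : tgt (gcomp fg) = src h) (f_gh : tgt f = src (gcomp gh)),
    gcomp fg_h = gcomp f_gh
}.

Lemma comp_idnl (O : Type) (G : groupoid O) (o : O) (f : arr G)
  (e : tgt (idn G o) = src f) : src f = o -> gcomp e = f.
Proof. by move=> fo; case: o / fo e => e; exact: comp_idl. Qed.

Lemma comp_idnr (O : Type) (G : groupoid O) (o : O) (f : arr G)
  (e : tgt f = src (idn G o)) : tgt f = o -> gcomp e = f.
Proof. by move=> fo; case: o / fo e => e; exact: comp_idr. Qed.

Record functor (O O' : Type) (G : groupoid O) (H : groupoid O') := Functor {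
  fobj : O -> O';
  farr : arr G -> arr H;
  farr_src : forall a, src (farr a) = fobj (src a);
  farr_tgt : forall a, tgt (farr a) = fobj (tgt a);
  farr_idn : forall o, farr (idn G o) = idn H (fobj o);
  farr_comp : forall f g (e : tgt f = src g) (e' : tgt (farr f) = src (farr g)),
    farr (gcomp e) = gcomp e'
}.

Definition functor_eq (O O' : Type) (G : groupoid O) (H : groupoid O')
    (F F' : functor G H) : Prop :=
  fobj F =1 fobj F' /\ farr F =1 farr F'.

Lemma functor_comp_subproof (O O' O'' : Type) (G : groupoid O)
    (H : groupoid O') (K : groupoid O'') (F : functor G H) (F' : functor H K)
    f g (e : tgt f = src g)
    (e' : tgt (farr F' (farr F f)) = src (farr F' (farr F g))) :
  farr F' (farr F (gcomp e)) = gcomp e'.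
Proof.
have e0 : tgt (farr F f) = src (farr F g) by rewrite farr_tgt farr_src e.
by rewrite (farr_comp e e0); apply: farr_comp.
Qed.

Definition functor_comp (O O' O'' : Type) (G : groupoid O)
    (H : groupoid O') (K : groupoid O'') (F' : functor H K) (F : functor G H) :
  functor G K.
Proof.
refine (@Functor _ _ G K (fobj F' \o fobj F) (farr F' \o farr F) _ _ _ _) => /=.
- by move=> a; rewrite !farr_src.
- by move=> a; rewrite !farr_tgt.
- by move=> o; rewrite !farr_idn.
- by move=> f g e e'; exact: functor_comp_subproof.
Defined.

Definition linked (O : Type) (G : groupoid O) (o o' : O) : Prop :=
  exists a : arr G, src a = o /\ tgt a = o'.

(* The empty groupoid counts as connected. *)
Definition connected_groupoid (O : Type) (G : groupoid O) : Prop :=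
  forall o o', linked G o o'.

Definition components (O : Type) (G : groupoid O) : set (set O) :=
  range (fun o => [set o' | linked G o o']).

Definition union_of_components (O : Type) (G : groupoid O) (S : set O) : Prop :=
  exists2 F : set (set O), F `<=` components G & S = \bigcup_(C in F) C.

Lemma linked_refl (O : Type) (G : groupoid O) (o : O) : linked G o o.
Proof. by exists (idn G o); rewrite src_idn tgt_idn. Qed.

Lemma linked_sym (O : Type) (G : groupoid O) (o o' : O) :
  linked G o o' -> linked G o' o.
Proof. by move=> [a [<- <-]]; exists (ginv a); rewrite src_inv tgt_inv. Qed.

Lemma linked_trans (O : Type) (G : groupoid O) (o o' o'' : O) :
  linked G o o' -> linked G o' o'' -> linked G o o''.
Proof.
move=> [a [<- ae]] [b [be <-]]; rewrite -be in ae.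
by exists (gcomp ae); rewrite src_comp tgt_comp.
Qed.

Lemma union_of_componentsP (O : Type) (G : groupoid O) (S : set O) :
  union_of_components G S <-> forall o o', linked G o o' -> S o -> S o'.
Proof.
split=> [[F FG ->] o o' oo' [C FC Co]|sat].
  exists C => //; have [p _ CE] := FG _ FC.
  by move: Co; rewrite -CE /= => po; exact: linked_trans oo'.
exists [set C | components G C /\ C `<=` S]; first by move=> C [].
rewrite eqEsubset; split=> [o So|o [C [_ CS]]]; last exact: CS.
exists [set o' | linked G o o']; last exact: linked_refl.
by split=> [|o' oo']; [exists o | exact: sat oo' So].
Qed.

Section FullSubgroupoid.
Variables (O : Type) (G : groupoid O) (S : set O).

Definition full_arr : set (arr G) := [set a | S (src a) /\ S (tgt a)].

Let fsrc (a : full_arr) : S := elt (proj1 (eltP a)).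
Let ftgt (a : full_arr) : S := elt (proj2 (eltP a)).

Lemma full_idn_subproof (o : S) : full_arr (idn G (val o)).
Proof. by split; rewrite ?src_idn ?tgt_idn; exact: eltP. Qed.

Lemma full_inv_subproof (a : full_arr) : full_arr (ginv (val a)).
Proof. by case: (eltP a) => ? ?; split; rewrite ?src_inv ?tgt_inv. Qed.

Lemma full_comp_subproof (f g : full_arr) (e : tgt (val f) = src (val g)) :
  full_arr (gcomp e).
Proof.
by case: (eltP f) => ? _; case: (eltP g) => _ ?; split;
  rewrite ?src_comp ?tgt_comp.
Qed.

(* The full subgroupoid of G on the set of objects S. *)
Definition full_subgroupoid : groupoid S.
Proof.
refine (@Groupoid S full_arr fsrc ftgt
  (fun o => elt (full_idn_subproof o)) (fun a => elt (full_inv_subproof a))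
  (fun f g e => elt (full_comp_subproof (congr1 val e)))
  _ _ _ _ _ _ _ _ _ _ _).
- by move=> o; apply: val_inj; rewrite /= src_idn.
- by move=> o; apply: val_inj; rewrite /= tgt_idn.
- by move=> f; apply: val_inj; rewrite /= src_inv.
- by move=> f; apply: val_inj; rewrite /= tgt_inv.
- by move=> f g e; apply: val_inj; rewrite /= src_comp.
- by move=> f g e; apply: val_inj; rewrite /= tgt_comp.
- by move=> f e; apply: val_inj; exact: comp_idl.
- by move=> f e; apply: val_inj; exact: comp_idr.
- by move=> f e; apply: val_inj; exact: comp_invl.
- by move=> f e; apply: val_inj; exact: comp_invr.
- by move=> f g h fg gh fg_h f_gh; apply: val_inj; exact: compA.
Defined.

End FullSubgroupoid.
Arguments full_arr {O} G S _.

Definition overlap (X : Type) (P Q : set X) : set P := [set o | Q (val o)].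
Arguments overlap {X} P Q _.

Definition overlap_swap (X : Type) (P Q : set X) (o : overlap P Q) :
  overlap Q P :=
  @elt _ (overlap Q P) (@elt _ Q (val (val o)) (eltP o)) (eltP (val o)).

Record local_system := LocalSystem {
  carrier : Type;
  aidx : Type;
  ale : aidx -> aidx -> Prop;
  dom : aidx -> set carrier;
  loc : forall a, groupoid (dom a);
  str : forall a b, ale a b ->
    functor (full_subgroupoid (loc a) (overlap (dom a) (dom b)))
            (full_subgroupoid (loc b) (overlap (dom b) (dom a)))
}.

(* [transports h f g]: the arrow f of the local groupoid at a lies over the
   intersection of the two object sets and the structural functor maps it to
   g. *)
Definition transports (A : local_system) (a b : aidx A) (h : ale a b)
    (f : arr (loc a)) (g : arr (loc b)) : Prop :=
  exists p, val (farr (str h) (@elt _ (full_arr _ _) f p)) = g.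

Record atlas := Atlas {
  system :> local_system;
  le_refl : forall a : aidx system, ale a a;
  overlap_components : forall a b : aidx system, ale a b ->
    union_of_components (loc a) (overlap (dom a) (dom b));
  str_obj : forall (a b : aidx system) (h : ale a b) o,
    val (val (fobj (str h) o)) = val (val o);
  str_refl : forall (a : aidx system) (h : ale a a) (f : arr (loc a)),
    transports h f f;
  str_comp : forall (a b c : aidx system) (ab : ale a b) (bc : ale b c)
    (ac : ale a c) f g h, transports ab f g -> transports bc g h ->
    transports ac f h;
  covered : \bigcup_(a in [set: aidx system]) dom a = [set: carrier system]
}.

Definition irreducible (A : atlas) : Prop :=
  forall a : aidx A, connected_groupoid (loc a).

Definition good (A : atlas) : Prop :=
  forall x : carrier A, exists2 a : aidx A, dom a x &
    forall b : aidx A, dom b x -> ale a b.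

Record morphism (A B : atlas) := Morphism {
  mset : carrier A -> carrier B;
  mindex : aidx A -> aidx B;
  mloc : forall a, functor (loc a) (loc (mindex a));
  mindex_le : forall a b, ale a b -> ale (mindex a) (mindex b);
  mloc_obj : forall a o, val (fobj (mloc a) o) = mset (val o);
  mloc_str : forall a b (h : ale a b) f g, transports h f g ->
    transports (mindex_le h) (farr (mloc a) f) (farr (mloc b) g)
}.

Definition morphism_comp (A B C : atlas) (g : morphism B C) (f : morphism A B) :
  morphism A C.
Proof.
refine (@Morphism A C (mset g \o mset f) (mindex g \o mindex f)
  (fun a => functor_comp (mloc g (mindex f a)) (mloc f a))
  (fun a b h => mindex_le g (mindex_le f h)) _ _).
- by move=> a o; rewrite /= !mloc_obj.
- by move=> a b h u v uv; do 2!apply: mloc_str.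
Defined.

(* Since A is covered, a corestriction f of f' has the same underlying function
   as f'. *)
Definition corestriction (A B : atlas) (f f' : morphism A B) : Prop :=
  forall a : aidx A, exists h : ale (mindex f a) (mindex f' a),
    forall u : arr (loc a), transports h (farr (mloc f a) u) (farr (mloc f' a) u).

Definition equivalent (A B : atlas) : morphism A B -> morphism A B -> Prop :=
  clos_refl_sym_trans _ (@corestriction A B).

Section Codiscrete.
Variable (O : Type).

Definition codiscrete : groupoid O.
Proof.
by refine (@Groupoid O (O * O)%type fst snd (fun o => (o, o))
  (fun f => (f.2, f.1)) (fun f g _ => (f.1, g.2)) _ _ _ _ _ _ _ _ _ _ _)
  => // -[] // a b [] // c d /= ->.
Defined.

End Codiscrete.

Section Products.
Variables (X Y : Type).

Definition fst_elt (P : set X) (Q : set Y) (o : P `*` Q) : P :=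
  elt (proj1 (eltP o)).

Definition snd_elt (P : set X) (Q : set Y) (o : P `*` Q) : Q :=
  elt (proj2 (eltP o)).

Definition pair_elt (P : set X) (Q : set Y) (o : P) (o' : Q) : P `*` Q :=
  @elt _ (P `*` Q) (val o, val o') (conj (eltP o) (eltP o')).

Lemma fst_pair_elt (P : set X) (Q : set Y) (o : P) (o' : Q) :
  fst_elt (pair_elt o o') = o.
Proof. exact: val_inj. Qed.

Lemma snd_pair_elt (P : set X) (Q : set Y) (o : P) (o' : Q) :
  snd_elt (pair_elt o o') = o'.
Proof. exact: val_inj. Qed.

Lemma eta_pair_elt (P : set X) (Q : set Y) (o : P `*` Q) :
  pair_elt (fst_elt o) (snd_elt o) = o.
Proof. by apply: val_inj; rewrite /=; case: (val o). Qed.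

Lemma pair_elt1 (P : set X) (Q : set Y) (o1 o2 : P) (o1' o2' : Q) :
  pair_elt o1 o1' = pair_elt o2 o2' -> o1 = o2.
Proof. by move=> /(congr1 (@fst_elt P Q)); rewrite !fst_pair_elt. Qed.

Lemma pair_elt2 (P : set X) (Q : set Y) (o1 o2 : P) (o1' o2' : Q) :
  pair_elt o1 o1' = pair_elt o2 o2' -> o1' = o2'.
Proof. by move=> /(congr1 (@snd_elt P Q)); rewrite !snd_pair_elt. Qed.

Definition product_groupoid (P : set X) (Q : set Y) (G : groupoid P)
  (H : groupoid Q) : groupoid (P `*` Q).
Proof.
refine (@Groupoid (P `*` Q) (arr G * arr H)%type
  (fun f => pair_elt (src f.1) (src f.2))
  (fun f => pair_elt (tgt f.1) (tgt f.2))
  (fun o => (idn G (fst_elt o), idn H (snd_elt o)))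
  (fun f => (ginv f.1, ginv f.2))
  (fun f g e => (gcomp (pair_elt1 e), gcomp (pair_elt2 e)))
  _ _ _ _ _ _ _ _ _ _ _).
- by move=> o /=; rewrite !src_idn eta_pair_elt.
- by move=> o /=; rewrite !tgt_idn eta_pair_elt.
- by move=> f /=; rewrite !src_inv.
- by move=> f /=; rewrite !tgt_inv.
- by move=> f g e /=; rewrite !src_comp.
- by move=> f g e /=; rewrite !tgt_comp.
- move=> [f f'] /= e; move: (pair_elt1 e) (pair_elt2 e).
  by rewrite fst_pair_elt snd_pair_elt => e1 e2; rewrite !comp_idl.
- move=> [f f'] /= e; move: (pair_elt1 e) (pair_elt2 e).
  by rewrite fst_pair_elt snd_pair_elt => e1 e2; rewrite !comp_idr.
- by move=> [f f'] /= e; rewrite !comp_invl fst_pair_elt snd_pair_elt.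
- by move=> [f f'] /= e; rewrite !comp_invr fst_pair_elt snd_pair_elt.
- by move=> f g h fg gh fg_h f_gh /=; congr pair; exact: compA.
Defined.

End Products.

Section ProductAtlas.
Variables (A B : atlas).

Let le_prod (i j : aidx A * aidx B) : Prop := ale i.1 j.1 /\ ale i.2 j.2.
Let dom_prod (i : aidx A * aidx B) : set (carrier A * carrier B) :=
  dom i.1 `*` dom i.2.
Let loc_prod (i : aidx A * aidx B) : groupoid (dom_prod i) :=
  product_groupoid (loc i.1) (loc i.2).
Let full_prod (i j : aidx A * aidx B) :=
  full_subgroupoid (loc_prod i) (overlap (dom_prod i) (dom_prod j)).

Section Structural.
Variables (i j : aidx A * aidx B) (h : le_prod i j).

Lemma full_fst_subproof (f : arr (full_prod i j)) :
  full_arr (loc i.1) (overlap (dom i.1) (dom j.1)) (val f).1.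
Proof. by have [[? _] [? _]] := eltP f. Qed.

Lemma full_snd_subproof (f : arr (full_prod i j)) :
  full_arr (loc i.2) (overlap (dom i.2) (dom j.2)) (val f).2.
Proof. by have [[_ ?] [_ ?]] := eltP f. Qed.

Let full_fst (f : arr (full_prod i j)) : arr (full_subgroupoid (loc i.1) _) :=
  elt (full_fst_subproof f).
Let full_snd (f : arr (full_prod i j)) : arr (full_subgroupoid (loc i.2) _) :=
  elt (full_snd_subproof f).
Let F1 (f : arr (full_prod i j)) :=
  farr (str (proj1 h)) (full_fst f).
Let F2 (f : arr (full_prod i j)) :=
  farr (str (proj2 h)) (full_snd f).

Lemma full_pair_subproof (f : arr (full_prod i j)) :
  full_arr (loc_prod j) (overlap (dom_prod j) (dom_prod i))
    (val (F1 f), val (F2 f)).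
Proof.
have [s1 t1] := eltP (F1 f); have [s2 t2] := eltP (F2 f).
by split; split.
Qed.

Definition product_str : functor (full_prod i j) (full_prod j i).
Proof.
refine (@Functor _ _ (full_prod i j) (full_prod j i)
  (fun o => overlap_swap o) (fun f => elt (full_pair_subproof f)) _ _ _ _).
- move=> f; do 2!apply: val_inj => /=; congr pair.
    rewrite -[val (src (val (F1 f)))]/(val (val (src (F1 f)))).
    by rewrite /F1 farr_src str_obj.
  rewrite -[val (src (val (F2 f)))]/(val (val (src (F2 f)))).
  by rewrite /F2 farr_src str_obj.
- move=> f; do 2!apply: val_inj => /=; congr pair.
    rewrite -[val (tgt (val (F1 f)))]/(val (val (tgt (F1 f)))).
    by rewrite /F1 farr_tgt str_obj.
  rewrite -[val (tgt (val (F2 f)))]/(val (val (tgt (F2 f)))).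
  by rewrite /F2 farr_tgt str_obj.
- move=> o; apply: val_inj => /=; congr pair.
  + rewrite /F1.
    have o1 : overlap (dom i.1) (dom j.1) (fst_elt (val o)).
      by have [] := eltP o.
    rewrite (_ : full_fst _ = idn (full_subgroupoid _ _) (elt o1)); last exact: val_inj.
    rewrite farr_idn /=; congr idn; apply: val_inj.
    by rewrite str_obj.
  + rewrite /F2.
    have o2 : overlap (dom i.2) (dom j.2) (snd_elt (val o)).
      by have [] := eltP o.
    rewrite (_ : full_snd _ = idn (full_subgroupoid _ _) (elt o2)); last exact: val_inj.
    rewrite farr_idn /=; congr idn; apply: val_inj.
    by rewrite str_obj.
- move=> f g e e'; apply: val_inj => /=; congr pair.
  + have e1 : tgt (full_fst f) = src (full_fst g).
      apply: val_inj => /=; exact: pair_elt1 (congr1 val e).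
    have e1' : tgt (F1 f) = src (F1 g) by rewrite /F1 farr_tgt farr_src e1.
    rewrite /F1 (_ : full_fst _ = gcomp e1); last by apply: val_inj; congr gcomp; exact: Prop_irrelevance.
    rewrite (farr_comp e1 e1') /=.
    congr gcomp; exact: Prop_irrelevance.
  + have e1 : tgt (full_snd f) = src (full_snd g).
      apply: val_inj => /=; exact: pair_elt2 (congr1 val e).
    have e1' : tgt (F2 f) = src (F2 g) by rewrite /F2 farr_tgt farr_src e1.
    rewrite {1}/F2 (_ : _ (gcomp e) = gcomp e1); last by apply: val_inj; congr gcomp; exact: Prop_irrelevance.
    rewrite (farr_comp e1 e1') /=.
    congr gcomp; exact: Prop_irrelevance.
Defined.

End Structural.

Definition product_system : local_system :=
  @LocalSystem (carrier A * carrier B) (aidx A * aidx B) le_prod dom_prod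
    loc_prod product_str.

Lemma product_transports (i j : aidx product_system) (h : ale i j)
    (f : arr (loc i)) (g : arr (loc j)) :
  transports h f g <->
  transports (proj1 h) f.1 g.1 /\ transports (proj2 h) f.2 g.2.
Proof.
split=> [[p <-]|[[p1 e1] [p2 e2]]].
  split; first by exists (full_fst_subproof (elt p : arr (full_prod i j))).
  by exists (full_snd_subproof (elt p : arr (full_prod i j))).
have p : full_arr (loc_prod i) (overlap (dom_prod i) (dom_prod j)) f.
  by have [? ?] := p1; have [? ?] := p2.
exists p; rewrite [g]surjective_pairing -e1 -e2.
rewrite (Prop_irrelevance p1 (full_fst_subproof (elt p : arr (full_prod i j)))).
by rewrite (Prop_irrelevance p2 (full_snd_subproof (elt p : arr (full_prod i j)))).
Qed.

Definition product_atlas : atlas.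
Proof.
refine (@Atlas product_system _ _ _ _ _ _).
- by move=> i; split; exact: le_refl.
- move=> i j [h1 h2]; apply/union_of_componentsP => o o' [f [<- <-]] [/= s1 s2].
  have /union_of_componentsP c1 := overlap_components h1.
  have /union_of_componentsP c2 := overlap_components h2.
  split=> /=.
    by apply: c1 s1; exists f.1.
  by apply: c2 s2; exists f.2.
- by [].
- by move=> i h f; apply/product_transports; split; exact: str_refl.
- move=> i j k ij jk ik f g h.
  move=> /product_transports[fg1 fg2] /product_transports[gh1 gh2].
  apply/product_transports; split.
    exact: str_comp fg1 gh1.
  exact: str_comp fg2 gh2.
- rewrite -subTset => -[x y] _.
  have [i _ xi] : (\bigcup_(a in [set: aidx A]) dom a) x by rewrite covered.
  have [j _ yj] : (\bigcup_(a in [set: aidx B]) dom a) y by rewrite covered.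
  by exists (i, j).
Defined.

End ProductAtlas.

(* The subsets {n} and {n, n+1} of the integers. *)
Inductive line_index := Vertex of int | Edge of int.

Definition line_dom (s : line_index) : set int :=
  match s with
  | Vertex n => [set n]
  | Edge n => [set n; n + 1]
  end.

Definition line_le (s t : line_index) : Prop := line_dom s `<=` line_dom t.

Section LineStructural.
Variables (s t : line_index) (h : line_le s t).

Let full_line (s t : line_index) :=
  full_subgroupoid (codiscrete (line_dom s)) (overlap (line_dom s) (line_dom t)).

Definition line_incl (o : line_dom s) : line_dom t := elt (h (eltP o)).

Lemma line_full_subproof (f : arr (full_line s t)) :
  full_arr (codiscrete (line_dom t)) (overlap (line_dom t) (line_dom s))
    (line_incl (val f).1, line_incl (val f).2).
Proof. by split; [exact: (eltP (val f).1) | exact: (eltP (val f).2)]. Qed.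

Definition line_str : functor (full_line s t) (full_line t s).
Proof.
refine (@Functor _ _ (full_line s t) (full_line t s)
  (fun o => overlap_swap o) (fun f => elt (line_full_subproof f)) _ _ _ _).
- by move=> f; do 2!apply: val_inj.
- by move=> f; do 2!apply: val_inj.
- by move=> o; apply: val_inj => /=; congr pair; apply: val_inj.
- by move=> f g e e'; apply: val_inj.
Defined.

End LineStructural.

Definition line_system : local_system :=
  @LocalSystem int line_index line_le line_dom
    (fun s => codiscrete (line_dom s)) line_str.

Lemma line_transports (s t : aidx line_system) (h : ale s t)
    (f : arr (loc s)) (g : arr (loc t)) :
  transports h f g <-> val f.1 = val g.1 /\ val f.2 = val g.2.
Proof.
split=> [[p <-] //|[e1 e2]].
have p : full_arr (codiscrete (line_dom s)) (overlap (line_dom s) (line_dom t)) f.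
  by split; apply: h; [exact: (eltP f.1) | exact: (eltP f.2)].
by exists p; rewrite [g]surjective_pairing /=; congr pair; apply: val_inj.
Qed.

Definition line : atlas.
Proof.
refine (@Atlas line_system _ _ _ _ _ _).
- by move=> s n.
- move=> s t h; apply: (proj2 (union_of_componentsP _ _)) => o o' _ _.
  exact: h (eltP o').
- by [].
- by move=> s h f; apply/line_transports.
- move=> a b c ab bc ac f g h.
  move=> /line_transports[e1 e2] /line_transports[e1' e2'].
  by apply/line_transports; rewrite e1 e2.
- by rewrite -subTset => n _; exists (Vertex n).
Defined.

Definition square : atlas := product_atlas line line.

Definition row_loc (N : int) (s : aidx line) :
  functor (loc s) (@loc square (s, Vertex N)).
Proof.
pose v : dom (Vertex N : aidx line) := @elt _ (line_dom (Vertex N)) N erefl.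
refine (@Functor _ _ (loc s) (@loc square (s, Vertex N))
  (fun o => pair_elt o v) (fun f => (f, idn (loc (Vertex N : aidx line)) v))
  _ _ _ _).
- by [].
- by [].
- by move=> o /=; rewrite fst_pair_elt snd_pair_elt.
- by [].
Defined.

Lemma row_le (N : int) (s t : aidx line) :
  ale s t -> @ale square (s, Vertex N) (t, Vertex N).
Proof. by move=> st; split=> // n. Qed.

(* The inclusion of the N-th row. *)
Definition row (N : int) : morphism line square.
Proof.
refine (@Morphism line square (fun n => (n, N)) (fun s => (s, Vertex N))
  (row_loc N) (@row_le N) _ _).
- by [].
- move=> s t h f g /line_transports[e1 e2].
  by apply/product_transports; split; apply/line_transports.
Defined.

Definition local_arrow (A : atlas) : Type := {a : aidx A & arr (loc a)}.

Definition local_id (A : atlas) (a : aidx A) (x : carrier A) (ax : dom a x) :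
  local_arrow A := existT _ a (idn (loc a) (elt ax)).

Definition morphism_arrow (A B : atlas) (f : morphism A B) (a : aidx A)
  (u : arr (loc a)) : local_arrow B := existT _ (mindex f a) (farr (mloc f a) u).

Definition step (n : int) : arr (loc (Edge n : aidx line)) :=
  (@elt _ (line_dom (Edge n)) n (or_introl erefl),
   @elt _ (line_dom (Edge n)) (n + 1) (or_intror erefl)).

(* The sequence of local arrows written lambda_n for lambda : L -> A. *)
Definition curve_arrow (A : atlas) (lam : morphism line A) (n : int) :
  local_arrow A := morphism_arrow lam (step n).

Definition stabilizes_left (A : atlas) (lam : morphism line A) (x : carrier A) :=
  exists (a : aidx A) (ax : dom a x) (N : int),
    forall n, n < N -> curve_arrow lam n = local_id ax.

Definition stabilizes_right (A : atlas) (lam : morphism line A) (x : carrier A) :=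
  exists (a : aidx A) (ax : dom a x) (N : int),
    forall n, N < n -> curve_arrow lam n = local_id ax.

Definition curve (A : atlas) : Type := quotient (@equivalent line A).

Definition represents (A : atlas) (lam : morphism line A) (l : curve A) : Prop :=
  val l lam.

Definition path (A : atlas) (x y : carrier A) : set (curve A) :=
  [set l | (exists2 lam, represents lam l & stabilizes_left lam x) /\
           (exists2 lam, represents lam l & stabilizes_right lam y)].

Definition homotopic (A : atlas) (x y : carrier A) (l l' : path x y) : Prop :=
  exists (H : morphism square A) (N0 N1 M0 M1 : int)
      (a0 : aidx A) (a0x : dom a0 x) (a1 : aidx A) (a1y : dom a1 y),
    [/\ represents (morphism_comp H (row N0)) (val l),
        represents (morphism_comp H (row N1)) (val l'),
        forall (i : aidx square) (f : arr (loc i)),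
          (val (src f)).1 < M0 -> morphism_arrow H f = local_id a0x &
        forall (i : aidx square) (f : arr (loc i)),
          M1 < (val (tgt f)).1 -> morphism_arrow H f = local_id a1y].

(* The sequences of local arrows determine mu up to the choice of the indices
   at the vertices {n}, hence determine its class when A is good.
   m follows l up to a stage where it has stabilized, and from then on a
   translate of l' which has not yet left its initial constant part. *)
Definition concatenation (A : atlas) (x y z : carrier A) (l : path x y)
    (l' : path y z) (m : path x z) : Prop :=
  exists (lam lam' mu : morphism line A) (a a' : aidx A)
      (ay : dom a y) (a'y : dom a' y) (N k : int),
    [/\ represents lam (val l), represents lam' (val l'),
        represents mu (val m) &
        (forall n, n < N -> curve_arrow mu n = curve_arrow lam n /\
                            curve_arrow lam' (n - k) = local_id a'y) /\
        (forall n, N <= n -> curve_arrow mu n = curve_arrow lam' (n - k) /\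
                             curve_arrow lam n = local_id ay)].

Definition pi1 (A : atlas) (x : carrier A) : Type := quotient (@homotopic A x x).

(* The graph of the multiplication induced by concatenation. *)
Definition pi1_product (A : atlas) (x : carrier A) (p q r : pi1 x) : Prop :=
  exists l l' m : path x x,
    [/\ p = cls _ l, q = cls _ l', r = cls _ m & concatenation l l' m].

HB.instance Definition _ (A : atlas) (x : carrier A) :=
  gen_eqMixin (pi1 x).
HB.instance Definition _ (A : atlas) (x : carrier A) :=
  gen_choiceMixin (pi1 x).

Definition pi1_law (A : atlas) (x : carrier A) : Type := isGroup (pi1 x).

Definition pi1_group (A : atlas) (x : carrier A) (m : pi1_law x) :
  groupType := let m' : isGroup (pi1 x) := m in HB.pack (pi1 x) m'.

Definition vertex (O : Type) (G : groupoid O) (o : O) : Type :=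
  [set f : arr G | src f = o /\ tgt f = o].

HB.instance Definition _ (O : Type) (G : groupoid O) (o : O) :=
  gen_eqMixin (vertex G o).
HB.instance Definition _ (O : Type) (G : groupoid O) (o : O) :=
  gen_choiceMixin (vertex G o).

Section VertexGroup.
Variables (O : Type) (G : groupoid O) (o : O).

Definition vertex_elt (f : arr G) (fo : src f = o /\ tgt f = o) : vertex G o :=
  @elt _ [set f : arr G | src f = o /\ tgt f = o] f fo.

Lemma vertexP (f : vertex G o) : src (val f) = o /\ tgt (val f) = o.
Proof. exact: eltP f. Qed.

Lemma vertex_composable (f g : vertex G o) : tgt (val f) = src (val g).
Proof. by rewrite (vertexP f).2 (vertexP g).1. Qed.

Definition vertex_one : vertex G o :=
  vertex_elt (conj (src_idn G o) (tgt_idn G o)).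

Definition vertex_inv (f : vertex G o) : vertex G o.
Proof.
apply: (@vertex_elt (ginv (val f))).
by rewrite src_inv tgt_inv (vertexP f).1 (vertexP f).2.
Defined.

Definition vertex_mul (f g : vertex G o) : vertex G o.
Proof.
apply: (@vertex_elt (gcomp (vertex_composable f g))).
by rewrite src_comp tgt_comp (vertexP f).1 (vertexP g).2.
Defined.

Lemma vertex_mulA : associative vertex_mul.
Proof. by move=> f g h; apply: val_inj; apply: esym; exact: compA. Qed.

Lemma vertex_mul1 : left_id vertex_one vertex_mul.
Proof. by move=> f; apply: val_inj; exact: comp_idnl (vertexP f).1. Qed.

Lemma vertex_1mul : right_id vertex_one vertex_mul.
Proof. by move=> f; apply: val_inj; exact: comp_idnr (vertexP f).2. Qed.

Lemma vertex_mulV : left_inverse vertex_one vertex_inv vertex_mul.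
Proof. by move=> f; apply: val_inj; rewrite /= comp_invl (vertexP f).2. Qed.

Lemma vertex_Vmul : right_inverse vertex_one vertex_inv vertex_mul.
Proof. by move=> f; apply: val_inj; rewrite /= comp_invr (vertexP f).1. Qed.

HB.instance Definition _ := isGroup.Build (vertex G o)
  vertex_mulA vertex_mul1 vertex_1mul vertex_mulV vertex_Vmul.

End VertexGroup.

(* Compatibility is required wherever the structural functor from a to b is
   defined. In an irreducible atlas this is on the whole local groupoid at a,
   or nowhere when the two object sets are disjoint; so is_colimit below is
   the colimit of the diagram of the local groupoids. *)
Record cocone (A : atlas) (O : Type) (G : groupoid O) := Cocone {
  leg : forall a : aidx A, functor (loc a) G;
  leg_str : forall (a b : aidx A) (h : ale a b) (f : arr (loc a))
    (g : arr (loc b)), transports h f g -> farr (leg b) g = farr (leg a) f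
}.

(* The universal property of the colimit of the local groupoids of A, in the
   category of groupoids. *)
Definition is_colimit (A : atlas) (O : Type) (G : groupoid O)
    (c : cocone A G) : Prop :=
  forall (O' : Type) (H : groupoid O') (d : cocone A H),
  exists2 F : functor G H,
    forall a, functor_eq (functor_comp F (leg c a)) (leg d a) &
    forall F' : functor G H,
      (forall a, functor_eq (functor_comp F' (leg c a)) (leg d a)) ->
      functor_eq F' F.

(* Main.v *)
From HB Require Import structures.
Require Import Defs.
From mathcomp Require Import all_boot monoid.
From mathcomp Require Import ssralg ssrnum ssrint order.
From mathcomp Require Import boolp classical_sets.
From mathcomp Require Import zify.
From Stdlib Require Import Relation_Operators.

Set Implicit Arguments.
Unset Strict Implicit.
Unset Printing Implicit Defensive.

Import Order.TTheory GRing.Theory Num.Theory.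
Local Open Scope classical_set_scope.
Local Open Scope ring_scope.

(** The isomorphism sends the class of a loop to its holonomy: each local arrow
    of the loop is mapped to the colimit G by the cocone c, and the product of
    these images, of which all but finitely many are identities, is taken in G.
    The theorem amounts to four facts.

    Holonomy is invariant under homotopy (homotopic_holonomy). A homotopy maps
    each unit square of the plane into one local groupoid, so it gives a
    commutative square in G; hence consecutive rows have the same product, the
    vertical sides being identities near both ends.

    Concatenation multiplies holonomies (concatenation_holonomy), and any two
    composable paths can be concatenated (trail_concatenation).

    Every element of the vertex group is a holonomy (eval_surj), and loops with
    the same holonomy are homotopic (holonomy_homotopic). For this the colimit
    is compared with an explicit groupoid, word_groupoid. Its arrows are words
    of local arrows, up to two kinds of steps: two neighbouring letters are
    replaced by two others with the same product in some local groupoid, or an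
    identity is appended. The local groupoids map to it compatibly, so the
    universal property gives a functor F from G to word_groupoid. Evaluation of
    words is a functor in the other direction, and evaluation after F is the
    identity by uniqueness, which gives surjectivity. Moreover F sends the value
    of a word to the class of the word, so words with the same value are linked
    by steps.

    Finally each step between words is a homotopy between the corresponding
    paths (grid_square): in the row of squares between the two words only the
    vertical edge between the two changed letters is not an identity. Stacking
    these rows gives a grid of commuting squares, and such a grid is a morphism
    from L x L (grid_morphism). Goodness enters here: at a vertex of the grid
    the initial index is below the indices of all edges and cells around it. It
    also shows that a path is determined by its local arrows, so that every
    path comes from a word (path_word). *)

(** * Composition as a total operation *)

Section TotalComposition.
Variables (O : Type) (G : groupoid O).
Implicit Types f g h : arr G.

(** Composition extended by junk, so that equations between composites can be
    rewritten without carrying the proofs of composability. The value f on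
    pairs that do not compose makes src_gmul and gmulidn unconditional. *)
Definition gmul f g : arr G :=
  if pselect (tgt f = src g) is left e then gcomp e else f.

Lemma gmulE f g (e : tgt f = src g) : gmul f g = gcomp e.
Proof.
rewrite /gmul; case: pselect => [e'|//].
by rewrite (Prop_irrelevance e e').
Qed.

Lemma src_gmul f g : src (gmul f g) = src f.
Proof. by rewrite /gmul; case: pselect => [e|//]; rewrite src_comp. Qed.

Lemma tgt_gmul f g : tgt f = src g -> tgt (gmul f g) = tgt g.
Proof. by move=> e; rewrite (gmulE e) tgt_comp. Qed.

Lemma gmulA f g h : tgt f = src g -> tgt g = src h ->
  gmul f (gmul g h) = gmul (gmul f g) h.
Proof.
move=> e e'; rewrite (gmulE e) (gmulE e').
have e1 : tgt f = src (gcomp e') by rewrite src_comp.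
have e2 : tgt (gcomp e) = src h by rewrite tgt_comp.
by rewrite (gmulE e1) (gmulE e2); apply: esym; apply: Defs.compA.
Qed.

Lemma idngmul f o : src f = o -> gmul (idn G o) f = f.
Proof.
move=> fo; have e : tgt (idn G o) = src f by rewrite tgt_idn.
by rewrite (gmulE e); exact: comp_idnl.
Qed.

Lemma gmulidn f o : gmul f (idn G o) = f.
Proof.
rewrite /gmul; case: pselect => // e; apply: comp_idnr.
by rewrite e src_idn.
Qed.

Lemma gmulVg f : gmul (ginv f) f = idn G (tgt f).
Proof. by rewrite (gmulE (tgt_inv f)) comp_invl. Qed.

Lemma gmulgV f : gmul f (ginv f) = idn G (src f).
Proof. by rewrite (gmulE (esym (src_inv f))) comp_invr. Qed.

Lemma gmulKg f g : tgt f = src g -> gmul (ginv f) (gmul f g) = g.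
Proof. by move=> e; rewrite gmulA ?tgt_inv// gmulVg idngmul. Qed.

Lemma gmulVKg f g : src f = src g -> gmul f (gmul (ginv f) g) = g.
Proof.
by move=> e; rewrite gmulA ?src_inv ?tgt_inv// gmulgV idngmul.
Qed.

Lemma gmul_cancel f g h : tgt f = src g -> tgt f = src h ->
  gmul f g = gmul f h -> g = h.
Proof. by move=> fg fh e; rewrite -(gmulKg fg) e gmulKg. Qed.

Lemma ginv_idn o : ginv (idn G o) = idn G o.
Proof. by rewrite -{2}(tgt_idn G o) -gmulVg gmulidn. Qed.

Lemma ginv_gmul f g : tgt f = src g ->
  ginv (gmul f g) = gmul (ginv g) (ginv f).
Proof.
move=> e; apply: (@gmul_cancel (gmul f g)).
- by rewrite src_inv.
- by rewrite tgt_gmul// src_gmul src_inv.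
- rewrite gmulgV src_gmul -gmulA ?src_gmul ?src_inv//.
  by rewrite gmulVKg ?src_inv// gmulgV.
Qed.

(** Replacing a potential d by its translate f d does not change the functor
    that it defines. *)
Lemma gmul_transl f g h : tgt f = src g -> src g = src h ->
  gmul (ginv (gmul f g)) (gmul f h) = gmul (ginv g) h.
Proof.
move=> fg gh; rewrite ginv_gmul// -gmulA ?tgt_inv ?src_inv ?src_gmul//.
by rewrite gmulKg// -gh.
Qed.

End TotalComposition.

Lemma farr_gmul (O O' : Type) (G : groupoid O) (H : groupoid O')
    (F : functor G H) (f g : arr G) : tgt f = src g ->
  farr F (gmul f g) = gmul (farr F f) (farr F g).
Proof.
move=> e; have e' : tgt (farr F f) = src (farr F g).
  by rewrite farr_tgt farr_src e.
by rewrite (gmulE e) (gmulE e'); exact: farr_comp.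
Qed.

Lemma farr_ginv (O O' : Type) (G : groupoid O) (H : groupoid O')
    (F : functor G H) (f : arr G) : farr F (ginv f) = ginv (farr F f).
Proof.
apply: (@gmul_cancel _ _ (farr F f)).
- by rewrite farr_src farr_tgt src_inv.
- by rewrite src_inv.
- rewrite -farr_gmul ?src_inv// !gmulgV farr_idn.
  by rewrite farr_src.
Qed.

(** The functor f |-> d (src f)^-1 d (tgt f). The local groupoids of the line
    and of the square have exactly one arrow between any two objects, so their
    functors are all of this form and are conveniently given by a potential
    d. *)
Section PotentialFunctor.
Variables (O O' : Type) (C : groupoid O) (D : groupoid O').
Variables (ob : O -> O') (o0 : O') (d : O -> arr D).
Hypotheses (src_d : forall o, src (d o) = o0)
  (tgt_d : forall o, tgt (d o) = ob o).

Definition potential_functor : functor C D.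
Proof.
refine (@Functor _ _ C D ob (fun f => gmul (ginv (d (src f))) (d (tgt f)))
  _ _ _ _).
- by move=> f; rewrite src_gmul src_inv.
- by move=> f; rewrite tgt_gmul ?tgt_inv ?src_d.
- by move=> o; rewrite src_idn tgt_idn gmulVg tgt_d.
- move=> f g e e'; rewrite -(gmulE e') src_comp tgt_comp.
  rewrite -gmulA ?tgt_inv ?src_gmul ?src_inv ?src_d ?e//.
  by rewrite gmulVKg// ?src_d.
Defined.

End PotentialFunctor.

(** * Transport of local arrows *)

Section Transport.
Variable A : atlas.
Implicit Types a b : aidx A.

Lemma transports_src a b (h : ale a b) f g :
  transports h f g -> val (src g) = val (src f).
Proof.
move=> [p <-].
rewrite -[src (val _)]/(val (src (farr (str h) (@elt _ (full_arr _ _) f p)))).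
by rewrite farr_src str_obj.
Qed.

Lemma transports_tgt a b (h : ale a b) f g :
  transports h f g -> val (tgt g) = val (tgt f).
Proof.
move=> [p <-].
rewrite -[tgt (val _)]/(val (tgt (farr (str h) (@elt _ (full_arr _ _) f p)))).
by rewrite farr_tgt str_obj.
Qed.

Lemma transports_inj a b (h h' : ale a b) f g g' :
  transports h f g -> transports h' f g' -> g = g'.
Proof.
move=> [p <-] [p' <-]; rewrite (Prop_irrelevance h' h).
by rewrite (Prop_irrelevance p p').
Qed.

Lemma transports_idn a b (h : ale a b) (x : carrier A) (ax : dom a x)
  (bx : dom b x) : transports h (idn (loc a) (elt ax)) (idn (loc b) (elt bx)).
Proof.
have p : full_arr (loc a) (overlap (dom a) (dom b)) (idn (loc a) (elt ax)).
  by split; rewrite ?src_idn ?tgt_idn.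
exists p; have abx : overlap (dom a) (dom b) (elt ax) by [].
rewrite (_ : elt p = idn (full_subgroupoid _ _) (elt abx)); last exact: val_inj.
rewrite farr_idn /=; congr idn; apply: val_inj.
by rewrite str_obj.
Qed.

Lemma transports_gmul a b (h : ale a b) f f' g g' :
  transports h f g -> transports h f' g' -> tgt f = src f' ->
  transports h (gmul f f') (gmul g g').
Proof.
move=> [p gE] [p' gE'] e.
pose u : arr (full_subgroupoid _ _) := @elt _ (full_arr _ _) f p.
pose u' : arr (full_subgroupoid _ _) := @elt _ (full_arr _ _) f' p'.
have eu : tgt u = src u' by apply: val_inj.
have ev : tgt (farr (str h) u) = src (farr (str h) u').
  by rewrite farr_tgt farr_src eu.
have -> : gmul g g' = val (gcomp ev) by rewrite -gE -gE' /= -gmulE.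
rewrite -(farr_comp eu ev).
have q : full_arr (loc a) (overlap (dom a) (dom b)) (gmul f f').
  rewrite (gmulE e); exact: (@full_comp_subproof _ _ _ u u').
exists q; congr (val (farr (str h) _)); apply: val_inj => /=.
by rewrite -gmulE.
Qed.

Lemma transports_ginv a b (h : ale a b) f g :
  transports h f g -> transports h (ginv f) (ginv g).
Proof.
move=> [p <-].
pose u : arr (full_subgroupoid _ _) := @elt _ (full_arr _ _) f p.
rewrite -[ginv (val _)]/(val (ginv (farr (str h) u))) -farr_ginv.
by exists (full_inv_subproof u); congr (val (farr (str h) _)); apply: val_inj.
Qed.

End Transport.

(** * Quotients *)

Section Quotient.
Variables (T : Type) (R : T -> T -> Prop).

Lemma cls_surj (q : quotient R) : exists t, cls R t = q.
Proof.
have [t _ tq] := eltP q.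
by exists t; apply: val_inj.
Qed.

Definition qrepr (q : quotient R) : T := sval (cid (cls_surj q)).

Lemma qreprK : cancel qrepr (cls R).
Proof. by move=> q; rewrite /qrepr; case: cid. Qed.

Hypotheses (Rxx : forall t, R t t) (Rsym : forall t u, R t u -> R u t)
  (Rtrans : forall t u v, R t u -> R u v -> R t v).

Lemma eq_cls t u : R t u -> cls R t = cls R u.
Proof.
move=> tu; apply: val_inj => /=; rewrite eqEsubset; split=> v /=.
  exact/Rtrans/Rsym.
exact: Rtrans.
Qed.

Lemma cls_eq t u : cls R t = cls R u -> R t u.
Proof.
move=> /(congr1 val)/= e; rewrite -[R t u]/([set v | R t v] u) e.
exact: Rxx.
Qed.

Lemma qreprP t : R (qrepr (cls R t)) t.
Proof. by apply: cls_eq; rewrite qreprK. Qed.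

End Quotient.

(** * Words of local arrows *)

Section LocalArrows.
Variables (A : atlas) (A_good : good A).
Implicit Types (a b : aidx A) (x y z : carrier A) (p q : local_arrow A).

Definition initial_index x : aidx A := s2val (cid2 (A_good x)).

Lemma initial_dom x : dom (initial_index x) x.
Proof. exact: s2valP (cid2 (A_good x)). Qed.

Lemma initial_le x b : dom b x -> ale (initial_index x) b.
Proof. exact: s2valP' (cid2 (A_good x)) b. Qed.

Definition initial_id x : local_arrow A := local_id (initial_dom x).

Definition lsrc p : carrier A := val (src (projT2 p)).
Definition ltgt p : carrier A := val (tgt (projT2 p)).
Definition linv p : local_arrow A :=
  existT _ (projT1 p) (ginv (projT2 p)).

Lemma lsrc_inv p : lsrc (linv p) = ltgt p.
Proof. by rewrite /lsrc /= src_inv. Qed.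

Lemma ltgt_inv p : ltgt (linv p) = lsrc p.
Proof. by rewrite /ltgt /= tgt_inv. Qed.

Lemma lsrc_local_id a x (ax : dom a x) : lsrc (local_id ax) = x.
Proof. by rewrite /lsrc src_idn. Qed.

Lemma ltgt_local_id a x (ax : dom a x) : ltgt (local_id ax) = x.
Proof. by rewrite /ltgt tgt_idn. Qed.

(** The counterpart of transports for an arrow packed with its index. *)
Definition moves_to p b (g : arr (loc b)) : Prop :=
  exists h : ale (projT1 p) b, transports h (projT2 p) g.

Lemma moves_to_src p b g : @moves_to p b g -> val (src g) = lsrc p.
Proof. by move=> [h /transports_src]. Qed.

Lemma moves_to_tgt p b g : @moves_to p b g -> val (tgt g) = ltgt p.
Proof. by move=> [h /transports_tgt]. Qed.

Lemma moves_to_refl a (f : arr (loc a)) : moves_to (existT _ a f) f.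
Proof. by exists (Defs.le_refl a); exact: str_refl. Qed.

Lemma moves_to_inj p b g g' : @moves_to p b g -> @moves_to p b g' -> g = g'.
Proof. by move=> [h pg] [h' pg']; exact: transports_inj pg pg'. Qed.

Lemma local_arrow_inj a (f g : arr (loc a)) :
  existT (fun a => arr (loc a)) a f = existT _ a g -> f = g.
Proof.
move=> e; apply: (@moves_to_inj (existT _ a f)); first exact: moves_to_refl.
by rewrite e; exact: moves_to_refl.
Qed.

Lemma moves_to_gmul a (f f' : arr (loc a)) b g g' :
  @moves_to (existT _ a f) b g -> moves_to (existT _ a f') g' ->
  tgt f = src f' -> moves_to (existT _ a (gmul f f')) (gmul g g').
Proof.
move=> [h fg] [h' fg'] e; exists h; apply: transports_gmul => //=.
by rewrite (Prop_irrelevance h h').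
Qed.

Lemma moves_to_ginv p b g : @moves_to p b g -> moves_to (linv p) (ginv g).
Proof. by move=> [h pg]; exists h; exact: transports_ginv. Qed.

Lemma moves_to_local_id a b x (ax : dom a x) (bx : dom b x) : ale a b ->
  moves_to (local_id ax) (idn (loc b) (elt bx)).
Proof. by move=> ab; exists ab; exact: transports_idn. Qed.

Lemma moves_to_initial_id b x (o : dom b) : val o = x ->
  moves_to (initial_id x) (idn (loc b) o).
Proof.
move=> ox; have bx : dom b x by rewrite -ox; exact: eltP.
rewrite (_ : o = elt bx); last exact: val_inj.
by apply: moves_to_local_id; exact: initial_le.
Qed.

Lemma lsrc_initial_id x : lsrc (initial_id x) = x.
Proof. exact: lsrc_local_id. Qed.

Lemma ltgt_initial_id x : ltgt (initial_id x) = x.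
Proof. exact: ltgt_local_id. Qed.

(** A unit square of the plane is mapped by a morphism from L x L into a single
    local groupoid; this is what such a morphism says of the four sides of the
    square, p then q being one way round and p' then q' the other. *)
Definition square_commutes p q p' q' : Prop :=
  exists b, exists g : arr (loc b), exists k : arr (loc b),
  exists g' : arr (loc b), exists k' : arr (loc b),
    [/\ moves_to p g, moves_to q k, moves_to p' g' & moves_to q' k'] /\
    [/\ tgt g = src k, tgt g' = src k' & gmul g k = gmul g' k'].

Lemma square_commutes_sym p q p' q' :
  square_commutes p q p' q' -> square_commutes p' q' p q.
Proof.
move=> [b [g [k [g' [k' [[? ? ? ?] [? ? e]]]]]]].
by exists b, g', k', g, k; split; split.
Qed.

Lemma square_commutes_ends p q p' q' : square_commutes p q p' q' ->
  [/\ lsrc p = lsrc p', ltgt q = ltgt q', ltgt p = lsrc q & ltgt p' = lsrc q'].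
Proof.
move=> [b [g [k [g' [k' [[pg qk pg' qk'] [e e' E]]]]]]].
rewrite -(moves_to_src pg) -(moves_to_src pg') -(moves_to_tgt qk).
rewrite -(moves_to_tgt qk') -(moves_to_tgt pg) -(moves_to_tgt pg').
rewrite -(moves_to_src qk) -(moves_to_src qk') e e'; split=> //; congr val.
  by have := congr1 (@src _ _) E; rewrite !src_gmul.
by have := congr1 (@tgt _ _) E; rewrite !tgt_gmul.
Qed.

Lemma moves_to_self p : moves_to p (projT2 p).
Proof. by case: p => a f; exact: moves_to_refl. Qed.

Lemma square_commutes_id p x y : lsrc p = x -> ltgt p = y ->
  square_commutes p (initial_id y) (initial_id x) p.
Proof.
move=> <- <-; exists (projT1 p), (projT2 p), (idn _ (tgt (projT2 p))),
  (idn _ (src (projT2 p))), (projT2 p).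
split; split; rewrite ?src_idn ?tgt_idn//; do ?exact: moves_to_self.
- exact: moves_to_initial_id.
- exact: moves_to_initial_id.
- by rewrite gmulidn idngmul.
Qed.

Fixpoint word x (w : seq (local_arrow A)) y : Prop :=
  if w is p :: w' then lsrc p = x /\ word (ltgt p) w' y else x = y.

Lemma word_cat x u v z :
  word x (u ++ v) z <-> exists y, word x u y /\ word y v z.
Proof.
elim: u x => [|p u IH] x /=.
  by split=> [|[y [->]]//]; exists x.
split=> [[px /IH[y [uy vy]]]|[y [[px uy] vy]]]; first by exists y.
by split=> //; apply/IH; exists y.
Qed.

(** Two neighbouring letters may be replaced by two letters with the same
    product in some local groupoid, and a trailing identity may be added.
    Unlike a rule that shortens words, the first rule leaves all the other
    letters in their places, so that it is realized by two squares in one row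
    of a grid. *)
Inductive word_step y : seq (local_arrow A) -> seq (local_arrow A) -> Prop :=
| StepSquare u v p q p' q' : square_commutes p q p' q' ->
    word_step y (u ++ [:: p, q & v]) (u ++ [:: p', q' & v])
| StepPad w : word_step y w (rcons w (initial_id y)).

Definition word_eq y := clos_refl_sym_trans _ (word_step y).

Lemma word_eq_refl y w : word_eq y w w. Proof. exact: rst_refl. Qed.

Lemma word_eq_sym y w w' : word_eq y w w' -> word_eq y w' w.
Proof. exact: rst_sym. Qed.

Lemma word_eq_trans y w w' w'' :
  word_eq y w w' -> word_eq y w' w'' -> word_eq y w w''.
Proof. exact: rst_trans. Qed.

Lemma word_eq_word x y w w' : word_eq y w w' -> (word x w y <-> word x w' y).
Proof.
elim=> [{}w {}w' [u v p q p' q' /square_commutes_ends[e1 e2 e3 e4]|{}w]|//|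
  {}w {}w' _ ->//|{}w {}w' w'' _ -> _ ->//].
  rewrite !word_cat /= e1 e2 e3 e4.
  by split=> -[z [uz [-> [_ vy]]]]; exists z.
rewrite -cats1 word_cat /= lsrc_initial_id ltgt_initial_id.
by split=> [wy|[z [wz [-> _]]]//]; exists y.
Qed.

Lemma word_eq_cat2l z u v v' : word_eq z v v' -> word_eq z (u ++ v) (u ++ v').
Proof.
elim=> [{}v {}v' [u' w p q p' q' sq|{}v]|{}v|{}v {}v' _|
  {}v {}v' v'' _ IH1 _ IH2].
- by rewrite !catA; apply: rst_step; exact: StepSquare.
- by rewrite -rcons_cat; apply: rst_step; exact: StepPad.
- exact: rst_refl.
- exact: rst_sym.
- exact: rst_trans IH1 IH2.
Qed.

Lemma word_eq_square z v p q p' q' : square_commutes p q p' q' ->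
  word_eq z [:: p, q & v] [:: p', q' & v].
Proof. by move=> sq; apply: rst_step; exact: (@StepSquare z [::]). Qed.

Lemma word_eq_pad z w : word_eq z (rcons w (initial_id z)) w.
Proof. by apply: rst_sym; apply: rst_step; exact: StepPad. Qed.

(** A leading identity is pushed to the end of the word, one letter at a
    time. *)
Lemma word_eq_idcons y v z : word y v z -> word_eq z (initial_id y :: v) v.
Proof.
elim: v y => [|p v IH] y /=; first by move=> ->; exact: (word_eq_pad z [::]).
move=> [py /IH pv]; apply: word_eq_trans (word_eq_cat2l [:: p] pv).
apply: word_eq_square; apply: square_commutes_sym.
exact: square_commutes_id.
Qed.

(** An identity appended to the first factor stands in the middle of the
    product, from where it travels through the second factor. *)
Lemma word_eq_cat2r y z w w' v : word y v z -> word_eq y w w' ->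
  word_eq z (w ++ v) (w' ++ v).
Proof.
move=> yv; elim=> [{}w {}w' [u w0 p q p' q' sq|{}w]|{}w|{}w {}w' _|
  {}w {}w' w'' _ IH1 _ IH2].
- by rewrite -!catA /=; apply: rst_step; exact: StepSquare.
- by rewrite cat_rcons; apply/rst_sym/word_eq_cat2l/word_eq_idcons.
- exact: rst_refl.
- exact: rst_sym.
- exact: rst_trans IH1 IH2.
Qed.

Lemma word_eq_moves_to p b (g : arr (loc b)) : moves_to p g ->
  word_eq (ltgt p) [:: p] [:: existT _ b g].
Proof.
move=> pg; apply: word_eq_trans (word_eq_pad _ [:: _]).
apply: word_eq_trans (word_eq_sym (word_eq_pad _ [:: _])) _ => /=.
apply: word_eq_square; exists b, g, (idn _ (tgt g)), g, (idn _ (tgt g)).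
have pI : moves_to (initial_id (ltgt p)) (idn (loc b) (tgt g)).
  by apply: moves_to_initial_id; exact: moves_to_tgt pg.
by split; split; rewrite ?src_idn//; exact: moves_to_refl.
Qed.

(** The product is followed by an identity, to keep the number of letters. *)
Lemma word_eq_gmul a (f g : arr (loc a)) : tgt f = src g ->
  word_eq (val (tgt g)) [:: existT _ a f; existT _ a g]
    [:: existT _ a (gmul f g)].
Proof.
move=> e; apply: word_eq_trans (word_eq_pad _ [:: _]) => /=.
apply: word_eq_square; exists a, f, g, (gmul f g), (idn _ (tgt g)).
split; split; rewrite ?tgt_gmul ?src_idn ?gmulidn//; do ?exact: moves_to_refl.
exact: moves_to_initial_id.
Qed.

Lemma word_eq_local_id a x (ax : dom a x) : word_eq x [:: local_id ax] [::].
Proof.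
apply: word_eq_trans (word_eq_pad x [::]); apply: word_eq_sym.
rewrite -[X in word_eq X]ltgt_initial_id.
by apply: word_eq_moves_to; apply: moves_to_initial_id.
Qed.

Lemma word_eq_linv p : word_eq (lsrc p) [:: p; linv p] [::].
Proof.
case: p => a f; rewrite /linv /=.
have e : tgt f = src (ginv f) by rewrite src_inv.
have := word_eq_gmul e; rewrite gmulgV tgt_inv => H.
apply: word_eq_trans H _.
have := word_eq_local_id (eltP (src f)); rewrite /local_id.
by rewrite (_ : elt _ = src f); last exact: val_inj.
Qed.

Lemma linvK p : linv (linv p) = p.
Proof.
case: p => a f; rewrite /linv /=; congr existT.
apply: (@gmul_cancel _ _ (ginv f)).
- by rewrite src_inv.
- by rewrite tgt_inv.
- by rewrite gmulgV gmulVg src_inv.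
Qed.

Definition word_inv (w : seq (local_arrow A)) := rev (map linv w).

Lemma word_invK : involutive word_inv.
Proof. by move=> w; rewrite /word_inv map_rev revK mapK//; exact: linvK. Qed.

Lemma word_inv_word x w y : word x w y -> word y (word_inv w) x.
Proof.
elim: w x => [|p w IH] x /=; first by move=> ->.
move=> [px /IH wy]; rewrite /word_inv /= rev_cons -cats1; apply/word_cat.
by exists (ltgt p); split=> //=; rewrite lsrc_inv ltgt_inv.
Qed.

Lemma word_eq_word_inv x w y : word x w y -> word_eq x (w ++ word_inv w) [::].
Proof.
elim: w x => [|p w IH] x /=; first by move=> _; exact: word_eq_refl.
move=> [px /IH wI]; rewrite /word_inv /= rev_cons -cats1 catA -cat1s.
apply: word_eq_trans (_ : word_eq x ([:: p] ++ [:: linv p]) _).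
  apply: word_eq_cat2l.
  rewrite -[X in word_eq _ _ X]cat0s; apply: word_eq_cat2r wI => /=.
  by rewrite lsrc_inv ltgt_inv.
by rewrite -px; exact: word_eq_linv.
Qed.

(** * The groupoid of words *)

Record typed_word := TypedWord {
  wsrc : carrier A;
  wseq : seq (local_arrow A);
  wtgt : carrier A;
  wordP : word wsrc wseq wtgt
}.

Definition same_word (t u : typed_word) : Prop :=
  [/\ wsrc t = wsrc u, wtgt t = wtgt u & word_eq (wtgt t) (wseq t) (wseq u)].

Lemma same_word_refl t : same_word t t.
Proof. by split=> //; exact: word_eq_refl. Qed.

Lemma same_word_sym t u : same_word t u -> same_word u t.
Proof. by move=> [? e ?]; split=> //; rewrite -e; exact: word_eq_sym. Qed.

Lemma same_word_trans t u v : same_word t u -> same_word u v -> same_word t v.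
Proof.
move=> [e1 e2 tu] [e3 e4 uv]; split; rewrite ?e1 ?e2//; rewrite -?e2//.
by apply: word_eq_trans tu _; rewrite e2.
Qed.

Local Notation wcls := (cls same_word).
Local Notation wrepr := (@qrepr _ same_word).

Let eq_wcls t u : same_word t u -> wcls t = wcls u.
Proof. exact: (eq_cls same_word_sym same_word_trans). Qed.

Let wreprP t : same_word (wrepr (wcls t)) t.
Proof. exact: (qreprP same_word_refl). Qed.

Definition word_concat t u (e : wtgt t = wsrc u) : typed_word.
Proof.
refine (@TypedWord (wsrc t) (wseq t ++ wseq u) (wtgt u) _).
apply/word_cat; exists (wtgt t); split; first exact: wordP.
by rewrite e; exact: wordP.
Defined.

Definition empty_word x : typed_word := @TypedWord x [::] x erefl.

Definition inverse_word t : typed_word :=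
  TypedWord (word_inv_word (wordP t)).

Lemma same_word_concat t u t' u'
    (e : wtgt t = wsrc u) (e' : wtgt t' = wsrc u') :
  same_word t t' -> same_word u u' ->
  same_word (word_concat e) (word_concat e').
Proof.
move=> [t1 t2 tt'] [u1 u2 uu']; split=> //=.
apply: word_eq_trans (word_eq_cat2l _ uu'); apply: word_eq_cat2r tt'.
by rewrite e; exact: wordP.
Qed.

(** The colimit of the local groupoids, in a form in which equality of arrows
    can be read back as a sequence of elementary steps between words. *)
Definition word_groupoid : groupoid (carrier A).
Proof.
refine (@Groupoid (carrier A) (quotient same_word)
  (fun f => wsrc (wrepr f)) (fun f => wtgt (wrepr f))
  (fun x => wcls (empty_word x)) (fun f => wcls (inverse_word (wrepr f)))
  (fun f g e => wcls (word_concat e)) _ _ _ _ _ _ _ _ _ _ _).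
- by move=> x; have [] := wreprP (empty_word x).
- by move=> x; have [] := wreprP (empty_word x).
- by move=> f; have [] := wreprP (inverse_word (wrepr f)).
- by move=> f; have [] := wreprP (inverse_word (wrepr f)).
- by move=> f g e; have [] := wreprP (word_concat e).
- by move=> f g e; have [] := wreprP (word_concat e).
- move=> f e; rewrite -[RHS]qreprK; apply: eq_wcls.
  have [e1 e2 e3] := wreprP (empty_word (wsrc (wrepr f))); split=> //=.
  rewrite /= -[X in word_eq _ _ X]cat0s; apply: word_eq_cat2r.
    exact: wordP.
  by move: e3; rewrite e2.
- move=> f e; rewrite -[RHS]qreprK; apply: eq_wcls.
  have [e1 e2 e3] := wreprP (empty_word (wtgt (wrepr f))); split=> //=.
  by rewrite -[X in word_eq _ _ X]cats0; exact: word_eq_cat2l.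
- move=> f e; apply: eq_wcls.
  have [e1 e2 e3] := wreprP (inverse_word (wrepr f)); split=> //=.
  apply: (@word_eq_trans _ _ (word_inv (wseq (wrepr f)) ++ wseq (wrepr f))).
    by apply: word_eq_cat2r (wordP _) _; move: e3; rewrite e2.
  rewrite -{2}[wseq _]word_invK; apply: word_eq_word_inv.
  exact: word_inv_word (wordP _).
- move=> f e; apply: eq_wcls.
  have [e1 e2 e3] := wreprP (inverse_word (wrepr f)); split=> //=.
  apply: word_eq_trans (word_eq_cat2l _ e3) _; rewrite e2.
  exact: word_eq_word_inv (wordP _).
- move=> f g h fg gh fg_h f_gh; apply: eq_wcls.
  have [e1 e2 e3] := wreprP (word_concat fg).
  have [e1' e2' e3'] := wreprP (word_concat gh).
  split=> //=.
  apply: (@word_eq_trans _ _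
    ((wseq (wrepr f) ++ wseq (wrepr g)) ++ wseq (wrepr h))).
    apply: word_eq_cat2r (wordP _) _.
    by move: e3; rewrite e2 /= gh.
  rewrite -catA; apply: word_eq_sym; apply: word_eq_cat2l.
  by move: e3'; rewrite e2'.
Defined.

Definition class_of_word x w y (P : word x w y) : arr word_groupoid :=
  wcls (TypedWord P).

Lemma class_of_word_repr x w y (P : word x w y) :
  same_word (wrepr (class_of_word P)) (TypedWord P).
Proof. exact: wreprP. Qed.

Lemma src_class_of_word x w y (P : word x w y) : src (class_of_word P) = x.
Proof. by have [] := wreprP (TypedWord P). Qed.

Lemma tgt_class_of_word x w y (P : word x w y) : tgt (class_of_word P) = y.
Proof. by have [] := wreprP (TypedWord P). Qed.

Lemma eq_class_of_word x w y x' w' y' (P : word x w y) (P' : word x' w' y') :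
  x = x' -> y = y' -> word_eq y w w' -> class_of_word P = class_of_word P'.
Proof. by move=> *; apply: eq_wcls; split. Qed.

Lemma class_of_word_eq x w w' y (P : word x w y) (P' : word x w' y) :
  class_of_word P = class_of_word P' -> word_eq y w w'.
Proof. by move=> /(cls_eq same_word_refl)[]. Qed.

Lemma gmul_class_of_word x w y w' z (P : word x w y) (P' : word y w' z)
    (Q : word x (w ++ w') z) :
  gmul (class_of_word P) (class_of_word P') = class_of_word Q.
Proof.
have e : tgt (class_of_word P) = src (class_of_word P').
  by rewrite tgt_class_of_word src_class_of_word.
rewrite (gmulE e); apply: eq_wcls.
have e' : wtgt (TypedWord P) = wsrc (TypedWord P') by [].
apply: same_word_trans (same_word_concat e e' (wreprP _) (wreprP _)) _.
exact: same_word_refl.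
Qed.

End LocalArrows.

(** * Words and the colimit *)

Section Colimit.
Variables (A : atlas) (A_good : good A).
Implicit Types (a b : aidx A) (x y z : carrier A) (p q : local_arrow A).

Local Notation word_eq := (word_eq A_good).
Local Notation words := (word_groupoid A_good).

Definition letter_class p : arr words :=
  @class_of_word _ _ (lsrc p) [:: p] (ltgt p) (conj erefl erefl).

Definition word_leg a : functor (loc a) words.
Proof.
refine (@Functor _ _ (loc a) words val (fun f => letter_class (existT _ a f))
  _ _ _ _).
- by move=> f; rewrite src_class_of_word.
- by move=> f; rewrite tgt_class_of_word.
- move=> o; apply: eq_class_of_word;
    rewrite ?/lsrc ?/ltgt /= ?src_idn ?tgt_idn//.
  have := word_eq_local_id A_good (eltP o); rewrite /local_id.
  by rewrite (_ : elt _ = o); last exact: val_inj.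
- move=> f g e e'; rewrite -!gmulE.
  have P : word (lsrc (existT _ a f)) ([:: existT _ a f] ++ [:: existT _ a g])
      (ltgt (existT _ a g)) by rewrite /= /lsrc /ltgt /= e.
  have P' : word (ltgt (existT _ a f)) [:: existT _ a g] (ltgt (existT _ a g)).
    by rewrite /= /lsrc /ltgt /= e.
  rewrite [letter_class (existT _ a g)](_ : _ = class_of_word A_good P').
    rewrite (gmul_class_of_word _ _ _ P); apply: eq_class_of_word.
    + by rewrite /lsrc /= src_gmul.
    + by rewrite /ltgt /= tgt_gmul.
    + by rewrite /ltgt /= tgt_gmul//; apply: word_eq_sym; exact: word_eq_gmul.
  apply: eq_class_of_word => //; last exact: word_eq_refl.
  by rewrite /lsrc /ltgt /= e.
Defined.

Definition word_cocone : cocone A words.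
Proof.
refine (@Cocone _ _ words word_leg _) => a b h f g fg.
apply: eq_class_of_word.
- exact: transports_src fg.
- exact: transports_tgt fg.
- apply: word_eq_sym; rewrite /ltgt /= (transports_tgt fg).
  by apply: (word_eq_moves_to A_good (p := existT _ a f)); exists h.
Defined.

Variables (O : Type) (G : groupoid O) (c : cocone A G).

Definition leg_arr p : arr G := farr (leg c (projT1 p)) (projT2 p).

Definition leg_obj x : O :=
  fobj (leg c (initial_index A_good x)) (elt (initial_dom A_good x)).

Lemma moves_to_leg p b (g : arr (loc b)) :
  moves_to p g -> leg_arr p = farr (leg c b) g.
Proof. by move=> [h pg]; rewrite /leg_arr (leg_str c pg). Qed.

Lemma fobj_leg a (o : dom a) : fobj (leg c a) o = leg_obj (val o).
Proof.
have := moves_to_leg (moves_to_initial_id A_good (erefl (val o))).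
rewrite /leg_arr /= !farr_idn => /(congr1 (@src _ _)).
by rewrite !src_idn.
Qed.

Lemma src_leg_arr p : src (leg_arr p) = leg_obj (lsrc p).
Proof. by rewrite /leg_arr farr_src fobj_leg. Qed.

Lemma tgt_leg_arr p : tgt (leg_arr p) = leg_obj (ltgt p).
Proof. by rewrite /leg_arr farr_tgt fobj_leg. Qed.

Lemma leg_local_id a x (ax : dom a x) :
  leg_arr (local_id ax) = idn G (leg_obj x).
Proof. by rewrite /leg_arr /= farr_idn fobj_leg. Qed.

Lemma leg_square p q p' q' : square_commutes p q p' q' ->
  gmul (leg_arr p) (leg_arr q) = gmul (leg_arr p') (leg_arr q').
Proof.
move=> [b [g [k [g' [k' [[pg qk pg' qk'] [e e' E]]]]]]].
rewrite (moves_to_leg pg) (moves_to_leg qk) (moves_to_leg pg').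
by rewrite (moves_to_leg qk') -!farr_gmul// E.
Qed.

Definition eval y (w : seq (local_arrow A)) : arr G :=
  foldr (fun p g => gmul (leg_arr p) g) (idn G (leg_obj y)) w.

Lemma src_eval x w y : word x w y -> src (eval y w) = leg_obj x.
Proof.
case: w => [|p w] /=; first by move=> ->; rewrite src_idn.
by move=> [<- _]; rewrite src_gmul src_leg_arr.
Qed.

Lemma tgt_eval x w y : word x w y -> tgt (eval y w) = leg_obj y.
Proof.
elim: w x => [|p w IH] x /=; first by rewrite tgt_idn.
move=> [_ wy]; rewrite tgt_gmul ?(IH _ wy)// (src_eval wy).
by rewrite tgt_leg_arr.
Qed.

Lemma eval_cat x w y w' z : word x w y -> word y w' z ->
  eval z (w ++ w') = gmul (eval y w) (eval z w').
Proof.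
move=> + wz; elim: w x => [|p w IH] x /=.
  by move=> _; rewrite idngmul// (src_eval wz).
move=> [_ wy]; rewrite (IH _ wy) gmulA//.
  by rewrite tgt_leg_arr (src_eval wy).
by rewrite (tgt_eval wy) (src_eval wz).
Qed.

Lemma eval_word_eq x w w' y : word x w y -> word_eq y w w' ->
  eval y w = eval y w'.
Proof.
move=> wy e; elim: e wy => [{}w {}w' st|//|{}w {}w' ww' IH|
  {}w {}w' w'' ww' IH _ IH'] wy.
- case: st wy => [u v p q p' q' sq|{}w]; last first.
    move=> wy; rewrite -cats1 (eval_cat wy)//=.
      by rewrite gmulidn leg_local_id gmulidn.
    by rewrite lsrc_initial_id ltgt_initial_id.
  rewrite word_cat => -[z [_ [_ [pq vy]]]].
  have [_ e2 _ pq'] := square_commutes_ends sq.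
  rewrite /eval !foldr_cat -!/(eval _ _); congr foldr => /=.
  rewrite !gmulA ?tgt_leg_arr ?src_leg_arr ?(src_eval vy) ?pq' ?e2 -?pq//.
  by rewrite (leg_square sq).
- by rewrite IH//; apply/(word_eq_word _ ww').
- by rewrite IH// IH'//; apply/(word_eq_word _ ww').
Qed.

Definition eval_functor : functor words G.
Proof.
pose r := @qrepr _ (@same_word _ A_good).
refine (@Functor _ _ words G leg_obj (fun f => eval (wtgt (r f)) (wseq (r f)))
  _ _ _ _).
- by move=> f; rewrite (src_eval (wordP _)).
- by move=> f; rewrite (tgt_eval (wordP _)).
- move=> x; have [e1 e2 e3] := qreprP (@same_word_refl _ A_good) (empty_word x).
  by rewrite (eval_word_eq (wordP _) e3) /r /= e2.
- move=> f g e e'; rewrite -!gmulE.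
  have [e1 e2 e3] := qreprP (@same_word_refl _ A_good) (word_concat e).
  rewrite (gmulE e) (eval_word_eq (wordP _) e3) /r e2 /=.
  apply: eval_cat; first exact: wordP.
  by rewrite [wtgt _]e; exact: wordP.
Defined.

Lemma eval_functor_class x w y (P : word x w y) :
  farr eval_functor (class_of_word A_good P) = eval y w.
Proof.
have [e1 e2 e3] := class_of_word_repr A_good P.
by rewrite /= (eval_word_eq (wordP _) e3) e2.
Qed.

Hypothesis c_colim : is_colimit c.

Definition id_functor : functor G G :=
  @Functor _ _ G G id id (fun=> erefl) (fun=> erefl) (fun=> erefl)
    (fun f g e e' => congr1 (@gcomp _ G f g) (Prop_irrelevance e e')).

(** The universal property gives F, and eval_functor after F is the identity
    because both are compatible with the cocone c. So every arrow of the
    colimit is the value of a word, and F recovers the class of the word. *)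
Lemma colimit_words :
  exists F : functor G words,
    [/\ forall x, fobj F (leg_obj x) = x,
        forall p, farr F (leg_arr p) = letter_class p &
        forall g, farr eval_functor (farr F g) = g].
Proof.
have [F Fleg _] := c_colim word_cocone.
have Fobj x : fobj F (leg_obj x) = x.
  exact: (Fleg _).1 (elt (initial_dom A_good x)).
have Farr p : farr F (leg_arr p) = letter_class p.
  by case: p => a f; exact: (Fleg a).2 f.
exists F; split=> // g.
have [F0 _ F0u] := c_colim c.
have /F0u[_ E1] : forall a,
    functor_eq (functor_comp id_functor (leg c a)) (leg c a).
  by [].
have /F0u[_ E2] : forall a, functor_eq
    (functor_comp (functor_comp eval_functor F) (leg c a)) (leg c a).
  move=> a; split=> [o|f].
    by have /= -> := (Fleg a).1 o; rewrite fobj_leg.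
  apply: etrans (congr1 (farr eval_functor) ((Fleg a).2 f)) _.
  by apply: etrans (eval_functor_class _) _; exact: gmulidn.
by have /= -> := E2 g; have /= <- := E1 g.
Qed.

Lemma eval_inj x w w' y : word x w y -> word x w' y ->
  eval y w = eval y w' -> word_eq y w w'.
Proof.
have [F [Fobj Farr _]] := colimit_words.
suff Fw u z (P : word z u y) : farr F (eval y u) = class_of_word A_good P.
  move=> P P' E; apply: (class_of_word_eq (P := P) (P' := P')).
  by rewrite -!Fw E.
elim: u z P => [|p u IH] z P /=.
  rewrite farr_idn Fobj; apply: eq_class_of_word => //; exact: word_eq_refl.
have [pz uy] := P; rewrite farr_gmul; last first.
  by rewrite tgt_leg_arr (src_eval uy).
have Q : word (lsrc p) ([:: p] ++ u) y by [].
rewrite Farr (IH _ uy) (gmul_class_of_word _ _ _ Q).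
by apply: eq_class_of_word => //; exact: word_eq_refl.
Qed.

Lemma eval_surj x y (g : arr G) : src g = leg_obj x -> tgt g = leg_obj y ->
  exists2 w, word x w y & eval y w = g.
Proof.
have [F [Fobj _ Fg]] := colimit_words => sg tg.
have Fs : src (farr F g) = x by rewrite farr_src sg Fobj.
have Ft : tgt (farr F g) = y by rewrite farr_tgt tg Fobj.
rewrite -Fs -Ft; eexists; first exact: wordP.
exact: Fg.
Qed.

End Colimit.

(** * Morphisms given by potentials *)

Section PotentialMorphism.
Variables (B A : atlas) (X : carrier B -> carrier A) (idx : aidx B -> aidx A).
Variables (base : forall i, dom (idx i))
  (d : forall i, carrier B -> arr (loc (idx i))).
Hypotheses (src_d : forall i z, dom i z -> src (d i z) = base i)
  (tgt_d : forall i z, dom i z -> val (tgt (d i z)) = X z)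
  (d_moves : forall i j, ale i j -> ale (idx i) (idx j) /\
    exists2 r : arr (loc (idx j)), tgt r = base j & forall z, dom i z ->
      dom j z -> moves_to (existT _ (idx i) (d i z)) (gmul r (d j z))).

(** Changing the base point translates the potential, and leaves the induced
    functor as it is; this is why the potentials of comparable indices need to
    agree only up to an arrow r. *)
Definition potential_morphism : morphism B A.
Proof.
refine (@Morphism B A X idx (fun i => potential_functor (loc i)
  (ob := fun o => tgt (d i (val o))) (o0 := base i)
  (d := fun o : dom i => d i (val o))
  (fun o => src_d (eltP o)) (fun=> erefl)) (fun i j ij => (d_moves ij).1) _ _).
- by move=> i o; apply: tgt_d; exact: eltP.
- move=> i j h f g fg /=.
  have [ij [r rj dr]] := d_moves h.
  have [sf tf] := (transports_src fg, transports_tgt fg).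
  have sj : dom j (val (src f)) by rewrite -sf; exact: eltP.
  have tj : dom j (val (tgt f)) by rewrite -tf; exact: eltP.
  have ms := dr _ (eltP (src f)) sj; have mt := dr _ (eltP (tgt f)) tj.
  have e : src (d i (val (src f))) = src (d i (val (tgt f))).
    by rewrite !src_d//; exact: eltP.
  have /= := moves_to_gmul (moves_to_ginv ms) mt; rewrite tgt_inv.
  move=> /(_ e)[h']; rewrite sf tf (Prop_irrelevance h' (d_moves h).1).
  by rewrite gmul_transl ?rj ?src_d.
Defined.

Lemma potential_morphism_arrow i (f : arr (loc i)) :
  morphism_arrow potential_morphism f =
  existT _ (idx i) (gmul (ginv (d i (val (src f)))) (d i (val (tgt f)))).
Proof. by []. Qed.

End PotentialMorphism.

(** * Curves *)

Section Curves.
Variables (A : atlas) (A_good : good A).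
Implicit Types (x y z : carrier A) (p q : local_arrow A) (n m : int).

Local Notation initial_index := (initial_index A_good).
Local Notation initial_dom := (initial_dom A_good).
Local Notation initial_id := (initial_id A_good).

Lemma line_leP (s t : line_index) : line_le s t ->
  s = t \/ exists n m, [/\ s = Vertex n, t = Edge m & n = m \/ n = m + 1].
Proof.
case: s t => n [m|m] h.
- by left; congr Vertex; exact: (h n erefl).
- by right; exists n, m; split=> //; exact: (h n erefl).
- have /= := h n (or_introl erefl); have /= := h (n + 1) (or_intror erefl).
  lia.
- left; congr Edge; have /= := h n (or_introl erefl).
  have /= := h (n + 1) (or_intror erefl); lia.
Qed.

Lemma moves_to_base b (f : arr (loc b)) x : val (tgt f) = x ->
  moves_to (initial_id x) (gmul (ginv f) f).
Proof. by move=> e; rewrite gmulVg; exact: moves_to_initial_id. Qed.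

Section CurveOf.
Variables (t : int -> local_arrow A)
  (t_conn : forall n, ltgt (t n) = lsrc (t (n + 1))).

Let idx (s : line_index) : aidx A :=
  match s with
  | Vertex n => initial_index (lsrc (t n))
  | Edge n => projT1 (t n)
  end.

Let base (s : line_index) : dom (idx s) :=
  match s with
  | Vertex n => elt (initial_dom (lsrc (t n)))
  | Edge n => src (projT2 (t n))
  end.

Let pot (s : line_index) (z : int) : arr (loc (idx s)) :=
  match s with
  | Vertex n => idn _ (base (Vertex n))
  | Edge n => if z == n then idn _ (base (Edge n)) else projT2 (t n)
  end.

(** A sequence of local arrows is a curve as soon as their ends match: the
    initial index at a vertex lies below the indices of both arrows that meet
    there. *)
Definition curve_of : morphism line A.
Proof.
refine (@potential_morphism line A (fun n => lsrc (t n)) idx base pot _ _ _).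
- by case=> n z /= _; rewrite ?src_idn//; case: eqP => _; rewrite ?src_idn.
- case=> n z /=; first by move=> ->; rewrite tgt_idn.
  case: eqP => [-> _|zn [//|->]]; first by rewrite tgt_idn.
  exact: t_conn.
- move=> i j /line_leP[<-|[n [m [-> -> nm]]]].
    split; first exact: Defs.le_refl.
    exists (idn _ (base i)) => [|z iz _]; first by rewrite tgt_idn.
    rewrite idngmul; first exact: moves_to_refl.
    by case: i iz => k /= _; rewrite ?src_idn//; case: eqP; rewrite ?src_idn.
  have tn : val (tgt (pot (Edge m) n)) = lsrc (t n).
    case: nm => -> /=; first by rewrite eqxx tgt_idn.
    by rewrite (_ : (m + 1 == m) = false); [exact: t_conn | lia].
  have mv := moves_to_base tn.
  split; first by case: mv.
  exists (ginv (pot (Edge m) n)) => [|z -> _ //].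
  by rewrite tgt_inv /=; case: eqP => _; rewrite ?src_idn.
Defined.

Lemma curve_arrow_curve_of n : curve_arrow curve_of n = t n.
Proof.
rewrite /curve_arrow potential_morphism_arrow /= eqxx.
case: eqP => [|_]; first lia.
by rewrite ginv_idn idngmul//; case: (t n).
Qed.

End CurveOf.

Lemma lsrc_curve_arrow (lam : morphism line A) n :
  lsrc (curve_arrow lam n) = mset lam n.
Proof. by rewrite /lsrc /= farr_src mloc_obj. Qed.

Lemma ltgt_curve_arrow (lam : morphism line A) n :
  ltgt (curve_arrow lam n) = mset lam (n + 1).
Proof. by rewrite /ltgt /= farr_tgt mloc_obj. Qed.

Lemma corestriction_moves_to (lam mu : morphism line A) n :
  corestriction lam mu ->
  moves_to (curve_arrow lam n) (projT2 (curve_arrow mu n)).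
Proof. by move=> H; have [h hu] := H (Edge n); exists h; exact: hu. Qed.

Lemma moves_to_corestriction (lam mu : morphism line A) :
  (forall n, mindex lam (Vertex n) = initial_index (mset lam n)) ->
  (forall n, moves_to (curve_arrow lam n) (projT2 (curve_arrow mu n))) ->
  corestriction lam mu.
Proof.
move=> lamV lamE.
have eX n : mset mu n = mset lam n.
  by rewrite -!lsrc_curve_arrow; have := moves_to_src (lamE n).
have mid s (o : dom (s : aidx line)) : ale (mindex lam s) (mindex mu s) ->
    moves_to (morphism_arrow lam (idn (loc s) o))
             (farr (mloc mu s) (idn (loc s) o)).
  move=> h; rewrite /morphism_arrow !farr_idn.
  have ax : dom (mindex lam s) (mset lam (val o)).
    by rewrite -mloc_obj; exact: eltP.
  have bx : dom (mindex mu s) (mset lam (val o)).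
    by rewrite -eX -mloc_obj; exact: eltP.
  rewrite (_ : fobj (mloc lam s) o = elt ax); last first.
    by apply: val_inj; rewrite mloc_obj.
  rewrite (_ : fobj (mloc mu s) o = elt bx); last first.
    by apply: val_inj; rewrite mloc_obj.
  exact: moves_to_local_id.
(* An arrow of an edge is an identity, the step or its inverse. *)
suff H s (u : arr (loc (s : aidx line))) :
    moves_to (morphism_arrow lam u) (farr (mloc mu s) u).
  move=> s; have [o _] : exists o : dom s, True.
    by case: s => n; [exists (@elt _ (line_dom (Vertex n)) n erefl)
      | exists (@elt _ (line_dom (Edge n)) n (or_introl erefl))].
  have [h _] := H s (idn _ o); exists h => u.
  by have [h' +] := H s u; rewrite (Prop_irrelevance h h').
case: s u => n u.
  have -> : u = idn (loc (Vertex n : aidx line)) (src u).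
    rewrite [u]surjective_pairing; congr pair; apply: val_inj.
    by rewrite /= (eltP u.1) (eltP u.2).
  apply: mid; rewrite lamV; apply: initial_le.
  rewrite -eX; have v : dom (Vertex n : aidx line) n by [].
  by rewrite -[n]/(val (elt v)) -mloc_obj; exact: eltP.
have h : ale (mindex lam (Edge n)) (mindex mu (Edge n)) by case: (lamE n).
have uE (v : arr (loc (Edge n : aidx line))) : val u.1 = val v.1 ->
    val u.2 = val v.2 -> u = v.
  by case: u v => [? ?] [? ?] /= /val_inj -> /val_inj ->.
have : dom (Edge n : aidx line) (val u.1) by exact: eltP.
have : dom (Edge n : aidx line) (val u.2) by exact: eltP.
move=> /= [u2|u2] [u1|u1].
- by rewrite (uE (idn _ (src (step n)))) ?u1 ?u2//; exact: mid.
- rewrite (uE (ginv (step n))) ?u1 ?u2// /morphism_arrow !farr_ginv.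
  exact: moves_to_ginv (lamE n).
- by rewrite (uE (step n)) ?u1 ?u2//; exact: lamE.
- by rewrite (uE (idn _ (tgt (step n)))) ?u1 ?u2//; exact: mid.
Qed.

(** With initial indices at the vertices, a curve is the least among those with
    the same local arrows; this is why only the local arrows matter for the
    class of a curve. *)
Lemma curve_of_corestriction t t_conn mu :
  (forall n, moves_to (t n) (projT2 (curve_arrow mu n))) ->
  corestriction (@curve_of t t_conn) mu.
Proof.
move=> H; apply: moves_to_corestriction => // n.
by rewrite curve_arrow_curve_of.
Qed.

End Curves.

(** * Homotopies from grids *)

Section Grid.
Variables (A : atlas) (A_good : good A).
Implicit Types (x y : carrier A) (p q : local_arrow A) (n m : int).

Local Notation initial_index := (initial_index A_good).
Local Notation initial_dom := (initial_dom A_good).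
Local Notation initial_id := (initial_id A_good).

Record filler p q p' q' := Filler {
  fidx : aidx A;
  fbot : arr (loc fidx);
  fright : arr (loc fidx);
  fleft : arr (loc fidx);
  ftop : arr (loc fidx);
  moves_bot : moves_to p fbot;
  moves_right : moves_to q fright;
  moves_left : moves_to p' fleft;
  moves_top : moves_to q' ftop;
  fbot_right : tgt fbot = src fright;
  fleft_top : tgt fleft = src ftop;
  fill : gmul fbot fright = gmul fleft ftop
}.

(** The initial index is chosen for a square all of whose sides are the
    identity there, so that a grid is constant wherever its edges are. *)
Lemma square_filler p q p' q' : square_commutes p q p' q' ->
  exists F : filler p q p' q', forall x, p = initial_id x ->
    q = initial_id x -> p' = initial_id x -> q' = initial_id x ->
    fidx F = initial_index x.
Proof.
move=> sq; case: (pselect (exists x, [/\ p = initial_id x, q = initial_id x,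
    p' = initial_id x & q' = initial_id x])) => [[x [-> -> -> ->]]|no].
  pose i := idn (loc (initial_index x)) (elt (initial_dom x)).
  have xi : moves_to (initial_id x) i by exact: moves_to_refl.
  have ii : tgt i = src i by rewrite src_idn tgt_idn.
  exists (Filler xi xi xi xi ii ii erefl) => y /=.
  by move=> /(congr1 (@projT1 _ _)).
case: sq => b [g [k [g' [k' [[pg qk pg' qk'] [e e' E]]]]]].
exists (Filler pg qk pg' qk' e e' E) => x *.
by case: no; exists x.
Qed.

Lemma filler_ends p q p' q' (F : filler p q p' q') :
  src (fleft F) = src (fbot F) /\ tgt (ftop F) = tgt (fright F).
Proof.
have E := fill F; have := congr1 (@src _ _) E; have := congr1 (@tgt _ _) E.
by rewrite !src_gmul (tgt_gmul (fbot_right F)) (tgt_gmul (fleft_top F)).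
Qed.

Section GridMorphism.
Variables (h v : int -> int -> local_arrow A).
Hypothesis hv : forall n m,
  square_commutes (h n m) (v (n + 1) m) (v n m) (h n (m + 1)).

Let sqF n m := cid (square_filler (hv n m)).
Let F n m := sval (sqF n m).

Let src_v n m : lsrc (v n m) = lsrc (h n m).
Proof. by have [-> _ _ _] := square_commutes_ends (hv n m). Qed.

Let tgt_v n m : ltgt (v n m) = lsrc (h n (m + 1)).
Proof. by have [_ _ _ ->] := square_commutes_ends (hv n m). Qed.

Let tgt_h n m : ltgt (h n m) = lsrc (h (n + 1) m).
Proof. by have [_ _ -> _] := square_commutes_ends (hv n m). Qed.

Let idx (i : line_index * line_index) : aidx A :=
  match i with
  | (Vertex n, Vertex m) => initial_index (lsrc (h n m))
  | (Edge n, Vertex m) => projT1 (h n m)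
  | (Vertex n, Edge m) => projT1 (v n m)
  | (Edge n, Edge m) => fidx (F n m)
  end.

Let base (i : line_index * line_index) : dom (idx i) :=
  match i with
  | (Vertex n, Vertex m) => elt (initial_dom (lsrc (h n m)))
  | (Edge n, Vertex m) => src (projT2 (h n m))
  | (Vertex n, Edge m) => src (projT2 (v n m))
  | (Edge n, Edge m) => src (fbot (F n m))
  end.

(** The base point is the lower left corner; in a cell the potential at the
    opposite corner goes round by the bottom, and by fill it could as well go
    round by the top. *)
Let pot (i : line_index * line_index) (z : int * int) : arr (loc (idx i)) :=
  match i with
  | (Vertex n, Vertex m) => idn _ (base (Vertex n, Vertex m))
  | (Edge n, Vertex m) =>
      if z.1 == n then idn _ (base (Edge n, Vertex m)) else projT2 (h n m)
  | (Vertex n, Edge m) =>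
      if z.2 == m then idn _ (base (Vertex n, Edge m)) else projT2 (v n m)
  | (Edge n, Edge m) =>
      if z.1 == n
      then if z.2 == m then idn _ (base (Edge n, Edge m)) else fleft (F n m)
      else if z.2 == m then fbot (F n m)
           else gmul (fbot (F n m)) (fright (F n m))
  end.

Let src_pot i z : src (pot i z) = base i.
Proof.
case: i => [[n|n] [m|m]] /=; do ?case: eqP => _; rewrite ?src_gmul ?src_idn//.
by case: (filler_ends (F n m)).
Qed.

Let succ_eqF n : (n + 1 == n) = false. Proof. lia. Qed.

Let tgt_pot (i : aidx square) (z : int * int) : dom i z ->
  val (tgt (pot i z)) = lsrc (h z.1 z.2).
Proof.
case: i z => [[n|n] [m|m]] [z1 z2] /= [].
- by move=> -> ->; rewrite tgt_idn.
- move=> -> [->|->]; rewrite ?eqxx ?succ_eqF; last exact: tgt_v.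
  by rewrite tgt_idn; exact: src_v.
- move=> [->|->] ->; rewrite ?eqxx ?succ_eqF; first by rewrite tgt_idn.
  exact: tgt_h.
- have tl := moves_to_tgt (moves_left (F n m)).
  have tb := moves_to_tgt (moves_bot (F n m)).
  have tr := moves_to_tgt (moves_right (F n m)).
  move=> [->|->] [->|->]; rewrite ?eqxx ?succ_eqF.
  + by rewrite tgt_idn; exact: (moves_to_src (moves_bot (F n m))).
  + by rewrite tl tgt_v.
  + by rewrite tb tgt_h.
  + by rewrite tgt_gmul; [rewrite tr tgt_v | exact: fbot_right].
Qed.

(** Potentials are compared after moving the base point of the larger index
    to a base point z0 of the smaller one. *)
Let pot_moves_at (i j : aidx square) z0 : dom i z0 -> dom j z0 ->
  pot i z0 = idn _ (base i) -> ale (idx i) (idx j) ->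
  (forall z, dom i z -> z != z0 -> moves_to (existT _ (idx i) (pot i z))
    (gmul (ginv (pot j z0)) (pot j z))) ->
  ale (idx i) (idx j) /\ exists2 r : arr (loc (idx j)), tgt r = base j &
    forall z, dom i z -> dom j z ->
      moves_to (existT _ (idx i) (pot i z)) (gmul r (pot j z)).
Proof.
move=> iz jz iE ij mv; split=> //; exists (ginv (pot j z0)).
  by rewrite tgt_inv src_pot.
move=> z zi _; have [->|] := eqVneq z z0; last exact: mv.
rewrite gmulVg iE; have := tgt_pot iz; rewrite iE tgt_idn => bi.
have jb : dom (idx j) (val (base i)) by rewrite bi -(tgt_pot jz); exact: eltP.
rewrite (_ : tgt _ = elt jb); last by apply: val_inj; rewrite (tgt_pot jz) -bi.
have := moves_to_local_id (eltP (base i)) jb ij; rewrite /local_id.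
by rewrite (_ : elt (eltP _) = base i); last exact: val_inj.
Qed.

Let pot_moves (i j : aidx square) : ale i j -> ale (idx i) (idx j) /\
  exists2 r : arr (loc (idx j)), tgt r = base j & forall z, dom i z ->
    dom j z -> moves_to (existT _ (idx i) (pot i z)) (gmul r (pot j z)).
Proof.
have initial n m j' : dom (j' : aidx square) (n, m) ->
    ale (initial_index (lsrc (h n m))) (idx j').
  by move=> jz; apply: initial_le; have <- := tgt_pot jz; exact: eltP.
case: i j => [s t] [s' t'] [/= /line_leP ss' /line_leP tt'].
case: ss' tt' => [<-|[n [n' [-> -> nn']]]] [<-|[m [m' [-> -> mm']]]].
- split; first exact: Defs.le_refl.
  exists (idn _ (base (s, t))) => [|z iz _]; first by rewrite tgt_idn.
  rewrite (idngmul (src_pot (s, t) z)).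
  exact: (moves_to_refl (pot (s, t) z)).
- case: s => n.
    have jz : dom ((Vertex n, Edge m') : aidx square) (n, m) by [].
    apply: (@pot_moves_at (Vertex n, Vertex m) (Vertex n, Edge m') (n, m))
      => //=.
      exact: (initial _ _ _ jz).
    by move=> [? ?] /= [-> ->]; rewrite eqxx.
  have jz : dom ((Edge n, Edge m') : aidx square) (n, m) by split; first left.
  have hm : moves_to (h n m) (gmul (ginv (pot (Edge n, Edge m') (n, m)))
      (pot (Edge n, Edge m') (n + 1, m))).
    case: mm' => -> /=; rewrite !eqxx !succ_eqF.
      by rewrite ginv_idn idngmul; [exact: moves_bot|].
    rewrite fill gmulKg; [exact: moves_top|exact: fleft_top].
  apply: (@pot_moves_at (Edge n, Vertex m) (Edge n, Edge m') (n, m)) => //.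
  + by split; first left.
  + by rewrite /= eqxx.
  + by case: hm.
  + move=> [z1 z2] [/= z1n ->]; case: z1n => ->; first by rewrite eqxx.
    move=> _; suff -> : existT (fun a => arr (loc a)) (idx (Edge n, Vertex m))
        (pot (Edge n, Vertex m) (n + 1, m)) = h n m by [].
    by rewrite /= succ_eqF; case: (h n m).
- case: t => m.
    have jz : dom ((Edge n', Vertex m) : aidx square) (n, m) by [].
    apply: (@pot_moves_at (Vertex n, Vertex m) (Edge n', Vertex m) (n, m))
      => //=.
      exact: (initial _ _ _ jz).
    by move=> [? ?] /= [-> ->]; rewrite eqxx.
  have jz : dom ((Edge n', Edge m) : aidx square) (n, m) by split; last left.
  have vm : moves_to (v n m) (gmul (ginv (pot (Edge n', Edge m) (n, m)))
      (pot (Edge n', Edge m) (n, m + 1))).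
    case: nn' => -> /=; rewrite !eqxx !succ_eqF.
      rewrite ginv_idn idngmul; first exact: moves_left.
      by case: (filler_ends (F n' m)).
    rewrite gmulKg; [exact: moves_right|exact: fbot_right].
  apply: (@pot_moves_at (Vertex n, Edge m) (Edge n', Edge m) (n, m)) => //.
  + by split; last left.
  + by rewrite /= eqxx.
  + by case: vm.
  + move=> [z1 z2] [/= -> z2m]; case: z2m => ->; first by rewrite eqxx.
    move=> _; suff -> : existT (fun a => arr (loc a)) (idx (Vertex n, Edge m))
        (pot (Vertex n, Edge m) (n, m + 1)) = v n m by [].
    by rewrite /= succ_eqF; case: (v n m).
- have jz : dom ((Edge n', Edge m') : aidx square) (n, m) by [].
  apply: (@pot_moves_at (Vertex n, Vertex m) (Edge n', Edge m') (n, m)) => //=.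
    exact: (initial _ _ _ jz).
  by move=> [? ?] /= [-> ->]; rewrite eqxx.
Qed.

Definition grid_morphism : morphism square A :=
  @potential_morphism square A (fun z => lsrc (h z.1 z.2)) idx base pot
    (fun i z _ => src_pot i z) tgt_pot pot_moves.

Lemma curve_arrow_row n m :
  curve_arrow (morphism_comp grid_morphism (row m)) n = h n m.
Proof.
rewrite -[LHS]/(existT _ (idx (Edge n, Vertex m)) (gmul
  (ginv (pot (Edge n, Vertex m) (n, m))) (pot (Edge n, Vertex m) (n + 1, m)))).
rewrite /= eqxx succ_eqF ginv_idn idngmul//.
by case: (h n m).
Qed.

Let is_id x b (f : arr (loc b)) :=
  existT (fun a => arr (loc a)) b f = initial_id x.

Let is_id_eq x b (f : arr (loc b)) (bx : b = initial_index x) :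
  moves_to (initial_id x) f -> is_id x f.
Proof.
subst b => mv; congr existT; apply: moves_to_inj mv _.
exact: moves_to_refl.
Qed.

Let is_id_gmul x b (f g : arr (loc b)) :
  is_id x f -> is_id x g -> is_id x (gmul f g).
Proof.
rewrite /is_id => e; have bx : b = initial_index x := congr1 (@projT1 _ _) e.
by subst b; rewrite (local_arrow_inj e) => /local_arrow_inj->; rewrite gmulidn.
Qed.

Let is_id_ginv x b (f : arr (loc b)) : is_id x f -> is_id x (ginv f).
Proof.
rewrite /is_id => e; have bx : b = initial_index x := congr1 (@projT1 _ _) e.
by subst b; rewrite (local_arrow_inj e) ginv_idn.
Qed.

Let is_id_src x b (f : arr (loc b)) : is_id x f -> is_id x (idn _ (src f)).
Proof. by move=> fx; rewrite -gmulgV; exact/is_id_gmul/is_id_ginv. Qed.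

Let is_id_proj x p : p = initial_id x -> is_id x (projT2 p).
Proof. by case: p. Qed.

(** This yields the endpoint conditions of a homotopy: a local arrow far enough
    to one side lies over a column whose edges are all identities. *)
Lemma grid_constant x n s t (f : arr (loc ((s, t) : aidx square))) :
  (forall m, [/\ h n m = initial_id x, v n m = initial_id x &
                 v (n + 1) m = initial_id x]) ->
  s = Vertex n \/ s = Edge n ->
  morphism_arrow grid_morphism f = initial_id x.
Proof.
move=> hx st; suff px z : is_id x (pot (s, t) z).
  exact: (is_id_gmul (is_id_ginv (px (val (src f)))) (px (val (tgt f)))).
have [h1 v1 v2] : [/\ forall m, h n m = initial_id x,
    forall m, v n m = initial_id x & forall m, v (n + 1) m = initial_id x].
  by split=> m; have [] := hx m.
case: st => ->; case: t f => m _ /=.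
- by apply: (congr1 initial_id); rewrite h1 lsrc_initial_id.
- have vx := is_id_proj (v1 m); case: eqP => _ //.
  exact: is_id_src.
- have hxm := is_id_proj (h1 m); case: eqP => _ //.
  exact: is_id_src.
- have Fx : fidx (F n m) = initial_index x by exact: (svalP (sqF n m)).
  have bx : is_id x (fbot (F n m)).
    by apply: is_id_eq => //; rewrite -(h1 m); exact: moves_bot.
  have rx : is_id x (fright (F n m)).
    by apply: is_id_eq => //; rewrite -(v2 m); exact: moves_right.
  have lx : is_id x (fleft (F n m)).
    by apply: is_id_eq => //; rewrite -(v1 m); exact: moves_left.
  case: eqP => _; case: eqP => _ //; first exact: is_id_src.
  exact: is_id_gmul.
Qed.

End GridMorphism.
End Grid.

(** * Paths and words *)

Section PathsWords.
Variables (A : atlas) (A_good : good A).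
Implicit Types (x y : carrier A) (p q : local_arrow A) (n m k : int).
Implicit Types (w : seq (local_arrow A)) (lam mu : morphism line A).

Local Notation initial_index := (initial_index A_good).
Local Notation initial_dom := (initial_dom A_good).
Local Notation initial_id := (initial_id A_good).
Local Notation curve_of := (curve_of A_good).

Definition connected_trail (t : int -> local_arrow A) : Prop :=
  forall n, ltgt (t n) = lsrc (t (n + 1)).

Definition trail x y k w n : local_arrow A :=
  if n < k then initial_id x else nth (initial_id y) w `|n - k|%N.

Lemma lsrc_nth_word x w y i : word x w y ->
  lsrc (nth (initial_id y) w i) =
  if i is j.+1 then ltgt (nth (initial_id y) w j) else x.
Proof.
elim: w x i => [|p w IH] x i /=.
  by move=> ->; rewrite nth_nil lsrc_initial_id; case: i => // i;
    rewrite nth_nil ltgt_initial_id.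
move=> [px wy]; case: i => [|i] //=; rewrite (IH _ _ wy).
by case: i.
Qed.

Lemma trail_connected x y k w : word x w y -> connected_trail (trail x y k w).
Proof.
move=> wy n; rewrite /trail; case: (ltP n k) => nk.
  rewrite ltgt_initial_id; case: (ltP (n + 1) k) => n1k.
    by rewrite lsrc_initial_id.
  by rewrite (_ : `|_|%N = 0%N) ?(lsrc_nth_word _ wy)//; lia.
rewrite (_ : (n + 1 < k) = false); last by lia.
by rewrite (_ : `|(n + 1)%R - k|%N = `|n - k|.+1) ?(lsrc_nth_word _ wy)//; lia.
Qed.

Lemma trail_left x y k w n : n < k -> trail x y k w n = initial_id x.
Proof. by rewrite /trail => ->. Qed.

Lemma trail_right x y k w n : k + (size w)%:Z <= n ->
  trail x y k w n = initial_id y.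
Proof.
move=> h; rewrite /trail (_ : (n < k) = false); last by lia.
by rewrite nth_default//; lia.
Qed.

Lemma trail_rcons x y k w :
  trail x y k (rcons w (initial_id y)) = trail x y k w.
Proof.
apply/funext => n; rewrite /trail; case: ifP => // _.
rewrite nth_rcons; case: ltnP => // h; rewrite nth_default//.
by case: ifP.
Qed.

Lemma trail_idcons x y k w :
  trail x y k (initial_id x :: w) = trail x y (k + 1) w.
Proof.
apply/funext => n; rewrite /trail; case: (ltP n k) => nk.
  by rewrite (_ : (n < k + 1) = true)//; lia.
case: (ltP n (k + 1)) => nk1; first by rewrite (_ : `|_|%N = 0%N)//; lia.
by rewrite (_ : `|n - k|%N = `|n - (k + 1)%R|.+1)//; lia.
Qed.

Definition trail_curve x y k w (P : word x w y) : morphism line A :=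
  curve_of (trail_connected k P).

Lemma equivalent_refl (lam : morphism line A) : equivalent lam lam.
Proof. exact: rst_refl. Qed.

Lemma equivalent_sym lam mu : equivalent lam mu -> equivalent mu lam.
Proof. exact: rst_sym. Qed.

Lemma equivalent_trans lam mu nu :
  equivalent lam mu -> equivalent mu nu -> equivalent lam nu.
Proof. exact: rst_trans. Qed.

Lemma represents_equivalent lam mu (l : curve A) :
  represents lam l -> represents mu l <-> equivalent lam mu.
Proof.
have [nu <-] := cls_surj l; rewrite /represents /= => nulam.
by split=> h; [exact/equivalent_trans/h/equivalent_sym
              | exact: equivalent_trans nulam h].
Qed.

Lemma represents_cls lam : represents lam (cls (@equivalent line A) lam).
Proof. exact: equivalent_refl. Qed.

Lemma trail_path_subproof x y k w (P : word x w y) :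
  Defs.path x y (cls (@equivalent line A) (trail_curve k P)).
Proof.
split; exists (trail_curve k P); do ?exact: represents_cls.
  exists (initial_index x), (initial_dom x), k => n nk.
  by rewrite curve_arrow_curve_of trail_left.
exists (initial_index y), (initial_dom y), (k + (size w)%:Z) => n nk.
by rewrite curve_arrow_curve_of trail_right//; exact: ltW.
Qed.

Definition trail_path x y k w (P : word x w y) : Defs.path x y :=
  elt (trail_path_subproof k P).

Lemma represents_trail_path x y k w (P : word x w y) :
  represents (trail_curve k P) (val (trail_path k P)).
Proof. exact: represents_cls. Qed.

(** * Every path comes from a word *)

Definition splice lam mu c n : local_arrow A :=
  if n < c then curve_arrow lam n else curve_arrow mu n.

Lemma splice_connected lam mu c : mset lam c = mset mu c ->
  connected_trail (splice lam mu c).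
Proof.
move=> e n; rewrite /splice; case: (ltP n c) => nc.
  case: (ltP (n + 1) c) => n1c; rewrite ltgt_curve_arrow lsrc_curve_arrow//.
  by rewrite (_ : n + 1 = c)//; lia.
rewrite (_ : (n + 1 < c) = false); last by lia.
by rewrite ltgt_curve_arrow lsrc_curve_arrow.
Qed.

Lemma corestriction_mset lam mu n : corestriction lam mu ->
  mset lam n = mset mu n.
Proof.
move=> /(corestriction_moves_to n)/moves_to_src.
by rewrite lsrc_curve_arrow -[val _]/(lsrc _) lsrc_curve_arrow.
Qed.

(** An equivalence of curves acts on each local arrow separately once the
    indices at the vertices are initial, so it can be performed on one side of
    c only. *)
Lemma splice_equivalent lam mu mu' c : equivalent mu mu' ->
  mset mu c = mset mu' c /\ forall (C : connected_trail (splice lam mu c))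
    (C' : connected_trail (splice lam mu' c)),
    equivalent (curve_of C) (curve_of C').
Proof.
pose Q mu mu' := mset mu c = mset mu' c /\ (mset lam c = mset mu c ->
    forall (C : connected_trail (splice lam mu c))
    (C' : connected_trail (splice lam mu' c)),
    equivalent (curve_of C) (curve_of C')).
move=> e; suff [e1 e2] : Q mu mu'.
  split=> // C C'; apply: e2.
  have := C (c - 1); rewrite subrK /splice ltxx.
  rewrite (_ : (c - 1 < c) = true); last by lia.
  by rewrite ltgt_curve_arrow lsrc_curve_arrow subrK.
elim: e => {mu mu'}[mu mu' h|mu|mu mu' _ [e h]|mu mu' mu'' _ [e h] _ [e' h']].
- split=> [|_ C C']; first exact: corestriction_mset.
  apply: rst_step; apply: curve_of_corestriction => n.
  rewrite curve_arrow_curve_of /splice; case: ifP => _.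
    exact: moves_to_self.
  exact: corestriction_moves_to.
- by split=> // _ C C'; rewrite (Prop_irrelevance C C'); exact: equivalent_refl.
- by split=> // e' C C'; apply/equivalent_sym/h; rewrite e' e.
- split=> [|le C C'']; first by rewrite e.
  have C' : connected_trail (splice lam mu' c).
    by apply: splice_connected; rewrite le.
  by apply: equivalent_trans (h le C C') (h' _ C' C''); rewrite le.
Qed.

Lemma word_mkseq lam c s :
  word (mset lam c) (mkseq (fun i => curve_arrow lam (c + i%:Z)) s)
    (mset lam (c + s%:Z)).
Proof.
elim: s => [|s IH]; first by rewrite addr0.
rewrite mkseqS -cats1; apply/word_cat; exists (mset lam (c + s%:Z)).
split=> //=; rewrite lsrc_curve_arrow ltgt_curve_arrow; split=> //.
by congr mset; lia.
Qed.

(** A path has one representative that stabilizes to the left and another one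
    that stabilizes to the right. Splicing them at a point where the first is
    still constant gives a representative with only finitely many nontrivial
    local arrows. *)
Lemma path_word x y (l : Defs.path x y) : exists k w (P : word x w y),
  represents (trail_curve k P) (val l).
Proof.
have [[lam lam_l [a [ax [N HN]]]] [mu mu_l [b [bY [M HM]]]]] := eltP l.
have lam_mu : equivalent mu lam by apply/(represents_equivalent _ mu_l).
pose s := `|N - M|.+1%N; pose w := mkseq (fun i => curve_arrow mu (N + i%:Z)) s.
have [e sp] := splice_equivalent lam N lam_mu.
have muN : mset mu N = x.
  rewrite e; have := ltgt_curve_arrow lam (N - 1); rewrite subrK => <-.
  by rewrite HN ?ltgt_local_id//; lia.
have muM : mset mu (N + s%:Z) = y.
  by rewrite -lsrc_curve_arrow HM ?lsrc_local_id//; lia.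
have P : word x w y by rewrite -muN -muM; exact: word_mkseq.
exists N, w, P; apply/(represents_equivalent _ lam_l).
have C : connected_trail (splice lam mu N) by exact: splice_connected.
have C' : connected_trail (splice lam lam N) by exact: splice_connected.
apply: (equivalent_trans (mu := curve_of C')).
  apply/equivalent_sym/rst_step/curve_of_corestriction => n.
  by rewrite /splice; case: ifP => _; exact: moves_to_self.
apply: (equivalent_trans (equivalent_sym (sp C C'))).
apply/equivalent_sym/rst_step/curve_of_corestriction => n.
rewrite curve_arrow_curve_of /splice /trail; case: (ltP n N) => nN.
  by rewrite HN//; exact: moves_to_initial_id.
case: (ltnP `|n - N|%N s) => ns; last first.
  rewrite nth_default ?size_mkseq// HM; last by lia.
  exact: moves_to_initial_id.
rewrite nth_mkseq// (_ : N + `|n - N|%:Z = n); last by lia.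
exact: moves_to_self.
Qed.

End PathsWords.

(** * Equal words give homotopic paths *)

Section WordHomotopy.
Variables (A : atlas) (A_good : good A).
Implicit Types (x y : carrier A) (p q : local_arrow A) (n m k : int).
Implicit Types (w : seq (local_arrow A)) (t : int -> local_arrow A).

Local Notation initial_index := (initial_index A_good).
Local Notation initial_dom := (initial_dom A_good).
Local Notation initial_id := (initial_id A_good).
Local Notation word_eq := (word_eq A_good).
Local Notation trail := (trail A_good).

Lemma square_commutes_flip p q p' q' : square_commutes p q p' q' ->
  square_commutes q' (linv q) (linv p') p.
Proof.
move=> [b [g [k [g' [k' [[pg qk pg' qk'] [e e' E]]]]]]].
have tk : tgt k' = tgt k by have := congr1 (@tgt _ _) E; rewrite !tgt_gmul.
have sg : src g' = src g by have := congr1 (@src _ _) E; rewrite !src_gmul.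
exists b, k', (ginv k), (ginv g'), g; split; split=> //;
  do ?exact: moves_to_ginv.
- by rewrite src_inv.
- by rewrite tgt_inv.
- apply: (@gmul_cancel _ _ g'); rewrite ?src_gmul ?src_inv//.
  rewrite gmulVKg// gmulA ?src_inv// -E -gmulA ?src_inv//.
  by rewrite gmulgV -e gmulidn.
Qed.

(** A homotopy from t to t' given by the edges of a grid. Grids, unlike
    homotopies of classes of curves, are easily flipped and stacked; the length
    J of the homotopy is additive under stacking. *)
Definition grid_between x y k t t' : Prop :=
  exists (h v : int -> int -> local_arrow A) (J K : int),
  [/\ 0 <= J,
      forall n m, square_commutes (h n m) (v (n + 1) m) (v n m) (h n (m + 1)),
      forall n m, m <= 0 -> h n m = t n,
      forall n m, J <= m -> h n m = t' n &
      (forall n m, n < k -> h n m = initial_id x) /\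
      (forall n m, n <= k -> v n m = initial_id x) /\
      (forall n m, K <= n -> h n m = initial_id y /\ v n m = initial_id y)].

Lemma grid_refl x y k w : word x w y ->
  grid_between x y k (trail x y k w) (trail x y k w).
Proof.
move=> wy; have C := trail_connected A_good k wy; set t := trail x y k w in C *.
exists (fun n _ => t n), (fun n _ => initial_id (lsrc (t n))), 0,
  (k + (size w)%:Z).
split=> //; first by move=> n m; exact: square_commutes_id.
split=> [n m|]; first exact: trail_left.
split=> n m; last by move=> ?; rewrite /t trail_right// lsrc_initial_id.
rewrite le_eqVlt => /orP[/eqP->|nk]; last first.
  by rewrite /t trail_left// lsrc_initial_id.
have := C (k - 1); rewrite subrK => <-.
by rewrite /t trail_left ?ltgt_initial_id//; lia.
Qed.

Lemma grid_sym x y k t t' : grid_between x y k t t' -> grid_between x y k t' t.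
Proof.
move=> [h [v [J [K [J0 sq h0 hJ [hx [vx hy]]]]]]].
have lid z : linv (initial_id z) = initial_id z.
  by rewrite /linv /= ginv_idn.
exists (fun n m => h n (J - m)), (fun n m => linv (v n (J - m - 1))), J, K.
split=> //.
- move=> n m; rewrite (_ : J - (m + 1) = J - m - 1); last by lia.
  apply: square_commutes_flip.
  by have := sq n (J - m - 1); rewrite subrK.
- by move=> n m m0; apply: hJ; lia.
- by move=> n m m0; apply: h0; lia.
- split=> [n m|]; first exact: hx.
  split=> n m nk; first by rewrite vx.
  by have [-> _] := hy n (J - m) nk; have [_ ->] := hy n (J - m - 1) nk.
Qed.

Lemma grid_trans x y k t t' t'' : grid_between x y k t t' ->
  grid_between x y k t' t'' -> grid_between x y k t t''.
Proof.
move=> [h [v [J [K [J0 sq h0 hJ [hx [vx hy]]]]]]].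
move=> [h' [v' [J' [K' [J0' sq' h0' hJ' [hx' [vx' hy']]]]]]].
exists (fun n m => if m < J then h n m else h' n (m - J)),
  (fun n m => if m < J then v n m else v' n (m - J)), (J + J'),
  (Num.max K K').
split; first lia.
- move=> n m; case: (ltP m J) => mJ; last first.
    rewrite (_ : (m + 1 < J) = false); last by lia.
    by rewrite (_ : m + 1 - J = m - J + 1); [exact: sq' | lia].
  case: (ltP (m + 1) J) => m1J //.
  by rewrite h0'; [rewrite -(hJ n (m + 1) m1J) | lia].
- move=> n m m0; case: ltP => mJ; first exact: h0.
  by rewrite h0'; [rewrite -(hJ n m) ?h0 | lia].
- by move=> n m mJ; rewrite (_ : (m < J) = false); [apply: hJ'|]; lia.
- split=> [n m nk|]; first by case: ifP => _; [exact: hx | exact: hx'].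
  split=> n m nk; first by case: ifP => _; [exact: vx | exact: vx'].
  by case: ifP => _; [apply: hy | apply: hy']; lia.
Qed.

(** One row of squares suffices: the vertical edge between the two changed
    letters is p^-1 p', and all other vertical edges are identities. *)
Lemma grid_square x y k u v p q p' q' : square_commutes p q p' q' ->
  word x (u ++ [:: p, q & v]) y ->
  grid_between x y k (trail x y k (u ++ [:: p, q & v]))
    (trail x y k (u ++ [:: p', q' & v])).
Proof.
move=> sq wy; set w := u ++ _ in wy *; set w' := u ++ _.
have wy' : word x w' y.
  have e : word_eq y w w' by apply: rst_step; exact: StepSquare.
  exact/(word_eq_word x e).
pose n0 : int := k + (size u)%:Z.
pose t := trail x y k w; pose t' := trail x y k w'.
have C n : ltgt (t n) = lsrc (t (n + 1)) := trail_connected A_good k wy n.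
have C' n : ltgt (t' n) = lsrc (t' (n + 1)) := trail_connected A_good k wy' n.
have tE n : n != n0 -> n != n0 + 1 -> t n = t' n.
  move=> nn0 nn1; rewrite /t /t' /trail; case: (ltP n k) => // nk.
  rewrite !nth_cat; case: ltnP => // un.
  by rewrite (_ : `|n - k| - size u = (`|n - k| - size u).-2.+2)%N//; lia.
have nth0 r : nth (initial_id y) (u ++ r) (size u) = nth (initial_id y) r 0.
  by rewrite nth_cat ltnn subnn.
have nth1 r : nth (initial_id y) (u ++ r) (size u).+1 = nth (initial_id y) r 1.
  by rewrite nth_cat ltnNge leqnSn subSn// subnn.
have at0 w0 : trail x y k w0 n0 = nth (initial_id y) w0 (size u).
  rewrite /trail (_ : (n0 < k) = false); last by lia.
  by rewrite (_ : `|n0 - k|%N = size u)//; lia.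
have at1 w0 : trail x y k w0 (n0 + 1) = nth (initial_id y) w0 (size u).+1.
  rewrite /trail (_ : (n0 + 1 < k) = false); last by lia.
  by rewrite (_ : `|(n0 + 1)%R - k|%N = (size u).+1)//; lia.
have [t0 t1] : t n0 = p /\ t (n0 + 1) = q by rewrite /t at0 at1 nth0 nth1.
have [t0' t1'] : t' n0 = p' /\ t' (n0 + 1) = q'.
  by rewrite /t' at0 at1 nth0 nth1.
have sE : lsrc (t n0) = lsrc (t' n0).
  by rewrite t0 t0'; case: (square_commutes_ends sq).
have eE n : n != n0 + 1 -> lsrc (t n) = lsrc (t' n).
  by have [->//|nn0 nn1] := eqVneq n n0; rewrite tE.
have [r [sq0 sq1]] : exists r, square_commutes p r (initial_id (lsrc p)) p' /\
    square_commutes q (initial_id (ltgt q)) r q'.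
  case: sq => b [g [l [g' [l' [[pg ql pg' ql'] [e e' E]]]]]].
  have sg : src g' = src g by have := congr1 (@src _ _) E; rewrite !src_gmul.
  have tl : tgt l' = tgt l by have := congr1 (@tgt _ _) E; rewrite !tgt_gmul.
  exists (existT _ b (gmul (ginv g) g')); split.
    exists b, g, (gmul (ginv g) g'), (idn _ (src g)), g'.
    split; split; rewrite ?src_gmul ?src_inv ?tgt_idn//.
    + exact: moves_to_refl.
    + by apply: moves_to_initial_id; exact: moves_to_src pg.
    + by rewrite gmulVKg// idngmul.
  exists b, l, (idn _ (tgt l)), (gmul (ginv g) g'), l'.
  split; split; rewrite ?src_idn ?tgt_gmul ?tgt_inv//.
  + by apply: moves_to_initial_id; exact: moves_to_tgt ql.
  + exact: moves_to_refl.
  + by rewrite gmulidn -gmulA ?tgt_inv// -E gmulKg.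
exists (fun n m => if m <= 0 then t n else t' n),
  (fun n m => if m == 0 then if n == n0 + 1 then r else initial_id (lsrc (t n))
              else initial_id (lsrc (if m <= 0 then t n else t' n))), 1,
  (k + (size w)%:Z).
have n0w : n0 + 1 < k + (size w)%:Z by rewrite /w size_cat /=; lia.
have ww' : size w' = size w by rewrite !size_cat.
split=> //.
- move=> n m; have [->|m0] := eqVneq m 0; last first.
    rewrite (_ : (m + 1 <= 0) = (m <= 0)); last by lia.
    by case: ifP => _; apply: square_commutes_id; rewrite ?C ?C'.
  rewrite lexx (_ : (0 + 1 <= 0) = false)//.
  rewrite (_ : (n + 1 == n0 + 1) = (n == n0)); last by lia.
  have [->|nn0] := eqVneq n n0.
    by rewrite t0 t0' (_ : (n0 == n0 + 1) = false)//; lia.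
  have [->|nn1] := eqVneq n (n0 + 1); first by rewrite -C t1 t1'.
  by rewrite -tE//; apply: square_commutes_id; rewrite ?C.
- by move=> n m ->.
- by move=> n m m1; rewrite (_ : (m <= 0) = false)//; lia.
- have lx n : n <= k -> lsrc (t n) = x /\ lsrc (t' n) = x.
    move=> nk; have := C (n - 1); have := C' (n - 1); rewrite subrK => <- <-.
    by rewrite /t /t' !trail_left ?ltgt_initial_id//; lia.
  split=> [n m nk|]; first by case: ifP => _; exact: trail_left.
  split=> n m nk.
    rewrite (_ : (n == n0 + 1) = false); last by rewrite /n0; lia.
    by have [l1 l2] := lx n nk; do 2?case: ifP => _; rewrite ?l1 ?l2.
  rewrite (_ : (n == n0 + 1) = false); last by lia.
  have ty : t n = initial_id y by exact: trail_right.
  have ty' : t' n = initial_id y by apply: trail_right; rewrite ww'.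
  by split; do 2?case: ifP => _; rewrite ?ty ?ty' ?lsrc_initial_id.
Qed.

Lemma grid_word_eq x y k w w' : word x w y -> word_eq y w w' ->
  grid_between x y k (trail x y k w) (trail x y k w').
Proof.
move=> + e; elim: e => [{}w {}w' [u v p q p' q' sq|{}w]|{}w|{}w {}w' e IH|
  {}w {}w' w'' e IH _ IH'] wy.
- exact: grid_square.
- by rewrite trail_rcons; exact: grid_refl.
- exact: grid_refl.
- by apply: grid_sym; apply: IH; apply/(word_eq_word x e).
- by apply: grid_trans (IH wy) (IH' _); apply/(word_eq_word x e).
Qed.

Lemma word_eq_homotopic x y k w w' (P : word x w y) (P' : word x w' y)
    (l l' : Defs.path x y) :
  represents (trail_curve A_good k P) (val l) ->
  represents (trail_curve A_good k P') (val l') ->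
  word_eq y w w' -> homotopic l l'.
Proof.
move=> wl wl' /(grid_word_eq k P)[h [v [J [K [_ sq h0 hJ [hx [vx hy]]]]]]].
exists (grid_morphism A_good sq), 0, J, k, K, (initial_index x),
  (initial_dom x), (initial_index y), (initial_dom y).
split.
- apply/(represents_equivalent _ wl)/rst_step/curve_of_corestriction => n.
  by rewrite curve_arrow_row h0//; exact: moves_to_self.
- apply/(represents_equivalent _ wl')/rst_step/curve_of_corestriction => n.
  by rewrite curve_arrow_row hJ//; exact: moves_to_self.
- move=> [s u] f fk.
  have [n [nk sE]] : exists n, n < k /\ (s = Vertex n \/ s = Edge n).
    have [sf _] := eltP (src f); case: s f fk sf => n f /= fk sf; exists n.
      by split; [rewrite -sf | left].
    by split; [lia | right].
  by apply: (grid_constant _ _ _ sE) => m; rewrite hx// !vx//; lia.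
- move=> [s u] f fK.
  have [n [nK sE]] : exists n, K <= n /\ (s = Vertex n \/ s = Edge n).
    have [sf _] := eltP (tgt f); case: s f fK sf => n f /= fK sf; exists n.
      by split; [rewrite -sf ltW | left].
    by split; [lia | right].
  apply: (grid_constant _ _ _ sE) => m; have [-> ->] := hy n m nK.
  by have [_ ->] := hy (n + 1) m ltac:(lia).
Qed.

(** Two words may be written at different places. Identities in front of the
    one that starts later give both the same start. *)
Lemma represents_trail_shift x y k w (P : word x w y) (l : Defs.path x y) j :
  represents (trail_curve A_good (k + j%:Z) P) (val l) ->
  exists w' (P' : word x w' y),
    represents (trail_curve A_good k P') (val l) /\ word_eq y w' w.
Proof.
elim: j w P => [|j IH] w P.
  rewrite addr0 => wl; exists w, P; split=> //; exact: word_eq_refl.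
have P' : word x (initial_id x :: w) y.
  by split; [exact: lsrc_initial_id | rewrite ltgt_initial_id].
move=> wl; have [|w' [Q [wl' ww']]] := IH _ P'.
  apply/(represents_equivalent _ wl)/rst_step/curve_of_corestriction => n.
  rewrite curve_arrow_curve_of trail_idcons (_ : k + j%:Z + 1 = k + j.+1%:Z).
    exact: moves_to_self.
  by lia.
exists w', Q; split=> //; apply: word_eq_trans ww' _; exact: word_eq_idcons.
Qed.

Lemma word_eq_path_homotopic x y k w (P : word x w y) k' w' (P' : word x w' y)
    (l l' : Defs.path x y) :
  represents (trail_curve A_good k P) (val l) ->
  represents (trail_curve A_good k' P') (val l') ->
  word_eq y w w' -> homotopic l l'.
Proof.
pose j : int := Num.min k k'.
rewrite (_ : k = j + `|k - j|%:Z); last by lia.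
rewrite (_ : k' = j + `|k' - j|%:Z); last by lia.
move=> /represents_trail_shift[u [Q [ul uw]]].
move=> /represents_trail_shift[u' [Q' [ul' uw']]] ww'.
apply: (word_eq_homotopic ul ul'); apply: word_eq_trans uw _.
exact: word_eq_trans ww' (word_eq_sym uw').
Qed.

End WordHomotopy.

(** * Holonomy of paths *)

Lemma downward_ind (P : int -> Prop) (N : int) : (forall n, N < n -> P n) ->
  (forall n, P (n + 1) -> P n) -> forall n, P n.
Proof.
move=> PN Pd n; have [/PN//|nN] := ltP N n.
suff H j : P (N + 1 - j%:Z).
  by have := H `|(N + 1)%R - n|%N; rewrite (_ : N + 1 - _ = n)//; lia.
elim: j => [|j IH]; first by apply: PN; lia.
by apply: Pd; rewrite (_ : N + 1 - j.+1%:Z + 1 = N + 1 - j%:Z)//; lia.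
Qed.

Section Holonomy.
Variables (A : atlas) (A_good : good A) (O : Type) (G : groupoid O).
Variable (c : cocone A G).
Implicit Types (x y z : carrier A) (p q : local_arrow A) (n m k : int).
Implicit Types (w : seq (local_arrow A)) (lam mu : morphism line A).

Local Notation initial_index := (initial_index A_good).
Local Notation initial_dom := (initial_dom A_good).
Local Notation initial_id := (initial_id A_good).
Local Notation trail := (trail A_good).
Local Notation leg_arr := (leg_arr c).
Local Notation leg_obj := (leg_obj A_good c).
Local Notation eval := (eval A_good c).

(** That g is the product of the two-sided infinite sequence t: q n is the
    product of the terms from n on. Carrying the whole sequence q avoids any
    choice of a first and a last nontrivial term, and q can be transformed term
    by term. *)
Definition holonomy y (t : int -> local_arrow A) (g : arr G) : Prop :=
  exists q : int -> arr G,
    [/\ forall n, q n = gmul (leg_arr (t n)) (q (n + 1)),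
        forall n, tgt (q n) = leg_obj y,
        exists M, forall n, n < M -> q n = g &
        exists M, forall n, M < n -> q n = idn G (leg_obj y)].

Lemma holonomy_inj y t g g' : holonomy y t g -> holonomy y t g' -> g = g'.
Proof.
move=> [q [qS _ [L qL] [R qR]]] [q' [qS' _ [L' qL'] [R' qR']]].
suff qq' n : q n = q' n.
  pose n := Num.min L L' - 1.
  by rewrite -(qL n) -?(qL' n) ?qq'//; lia.
apply: (@downward_ind (fun n => q n = q' n) (Num.max R R')) => {}n; last first.
  by move=> /= e; rewrite qS e -qS'.
by move=> nR; rewrite qR ?qR'//; lia.
Qed.

Lemma holonomy_ext y t t' g : (forall n, leg_arr (t n) = leg_arr (t' n)) ->
  holonomy y t g -> holonomy y t' g.
Proof.
by move=> e [q [qS qT qL qR]]; exists q; split=> // n; rewrite -e.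
Qed.

Lemma leg_initial_id x : leg_arr (initial_id x) = idn G (leg_obj x).
Proof. exact: leg_local_id. Qed.

Lemma holonomy_trail x y k w : word x w y ->
  holonomy y (trail x y k w) (eval y w).
Proof.
move=> wy; pose i n := if n < k then 0%N else `|n - k|%N.
have wi j : word (lsrc (nth (initial_id y) w j)) (drop j w) y.
  elim: w x wy j => [|p w IH] x /=.
    by move=> _ j; rewrite nth_nil; exact: lsrc_initial_id.
  by move=> [_ wy] [|j] //=; exact: IH wy j.
exists (fun n => eval y (drop (i n) w)); split.
- move=> n; rewrite /i /trail; case: (ltP n k) => nk.
    rewrite (_ : (if n + 1 < k then _ else _) = 0%N); last by case: ltP; lia.
    by rewrite drop0 leg_initial_id idngmul// (src_eval _ _ wy).
  rewrite (_ : (n + 1 < k) = false); last by lia.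
  rewrite (_ : `|(n + 1)%R - k|%N = `|n - k|.+1); last by lia.
  move: `|n - k|%N => j; case: (ltnP j (size w)) => jw.
    by rewrite (drop_nth (initial_id y) jw).
  rewrite nth_default// !drop_oversize ?leqW//= leg_initial_id.
  by rewrite gmulidn.
- by move=> n; exact: tgt_eval _ _ (wi _).
- by exists k => n nk; rewrite /i nk drop0.
- exists (k + (size w)%:Z) => n nk; rewrite drop_oversize// /i.
  by rewrite (_ : (n < k) = false); lia.
Qed.

Lemma equivalent_leg lam mu n : equivalent lam mu ->
  leg_arr (curve_arrow lam n) = leg_arr (curve_arrow mu n).
Proof.
elim=> [{}lam {}mu h|//|{}lam {}mu _ ->//|{}lam {}mu nu _ -> _ ->//].
exact: moves_to_leg (corestriction_moves_to n h).
Qed.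

Lemma represents_leg lam mu (l : curve A) n :
  represents lam l -> represents mu l ->
  leg_arr (curve_arrow lam n) = leg_arr (curve_arrow mu n).
Proof.
by move=> laml /(represents_equivalent _ laml) e; exact: equivalent_leg.
Qed.


Definition path_holonomy x y (l : Defs.path x y) g : Prop :=
  exists2 lam, represents lam (val l) & holonomy y (curve_arrow lam) g.

Lemma represents_holonomy x y (l : Defs.path x y) lam g :
  represents lam (val l) -> path_holonomy l g ->
  holonomy y (curve_arrow lam) g.
Proof.
move=> laml [mu mul]; apply: holonomy_ext => n.
exact: represents_leg mul laml.
Qed.

Lemma path_holonomy_inj x y (l : Defs.path x y) g g' :
  path_holonomy l g -> path_holonomy l g' -> g = g'.
Proof.
move=> [lam laml lamg] /(represents_holonomy laml).
exact: holonomy_inj lamg.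
Qed.

Lemma trail_holonomy x y k w (P : word x w y) (l : Defs.path x y) :
  represents (trail_curve A_good k P) (val l) -> path_holonomy l (eval y w).
Proof.
move=> wl; exists (trail_curve A_good k P) => //.
apply: holonomy_ext (holonomy_trail k P) => n.
by rewrite curve_arrow_curve_of.
Qed.

(** * Homotopic paths have the same holonomy *)

Section MorphismLeg.
Variables (B : atlas) (H : morphism B A).
Implicit Types (i j : aidx B).

Definition morphism_leg i (u : arr (loc i)) : arr G :=
  leg_arr (morphism_arrow H u).

Lemma src_morphism_leg i (u : arr (loc i)) :
  src (morphism_leg u) = leg_obj (mset H (val (src u))).
Proof.
by rewrite /morphism_leg (src_leg_arr A_good) /lsrc /= farr_src mloc_obj.
Qed.

Lemma tgt_morphism_leg i (u : arr (loc i)) :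
  tgt (morphism_leg u) = leg_obj (mset H (val (tgt u))).
Proof.
by rewrite /morphism_leg (tgt_leg_arr A_good) /ltgt /= farr_tgt mloc_obj.
Qed.

Lemma morphism_leg_transports i j (h : ale i j) u v :
  transports h u v -> morphism_leg u = morphism_leg v.
Proof.
move=> uv; apply: (@moves_to_leg _ _ _ c (morphism_arrow H u)).
by exists (mindex_le H h); exact: mloc_str.
Qed.

Lemma morphism_leg_gmul i (u v : arr (loc i)) : tgt u = src v ->
  morphism_leg (gmul u v) = gmul (morphism_leg u) (morphism_leg v).
Proof.
move=> e; rewrite /morphism_leg /leg_arr /= !farr_gmul//.
by rewrite farr_tgt farr_src e.
Qed.

End MorphismLeg.

Section Square.
Variable H : morphism square A.

Local Notation lh := (morphism_leg H).

Let pt n : dom (Vertex n : aidx line) := @elt _ (line_dom (Vertex n)) n erefl.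

Definition horizontal n m : arr (@loc square (Edge n, Vertex m)) :=
  (step n, idn (loc (Vertex m : aidx line)) (pt m)).

Definition vertical n m : arr (@loc square (Vertex n, Edge m)) :=
  (idn (loc (Vertex n : aidx line)) (pt n), step m).

Let cell n m : aidx square := (Edge n, Edge m).

(** All four sides are transported into the local groupoid of the cell, where
    there is only one arrow from the lower left to the upper right corner. *)
Lemma leg_cell n m :
  gmul (lh (horizontal n m)) (lh (vertical (n + 1) m)) =
  gmul (lh (vertical n m)) (lh (horizontal n (m + 1))).
Proof.
pose e0 k := src (step k); pose e1 k := tgt (step k).
pose id0 k := idn (loc (Edge k : aidx line)) (e0 k).
pose id1 k := idn (loc (Edge k : aidx line)) (e1 k).
pose bot : arr (loc (cell n m)) := (step n, id0 m).
pose right : arr (loc (cell n m)) := (id1 n, step m).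
pose left : arr (loc (cell n m)) := (id0 n, step m).
pose top : arr (loc (cell n m)) := (step n, id1 m).
have V0 k : @ale line (Vertex k) (Edge k) by move=> j ->; left.
have V1 k : @ale line (Vertex (k + 1)) (Edge k) by move=> j ->; right.
have E k : @ale line (Edge k) (Edge k) by [].
have -> : lh (horizontal n m) = lh bot.
  have h : @ale square (Edge n, Vertex m) (cell n m).
    by split; [exact: E | exact: V0].
  apply: (morphism_leg_transports H (h := h)); apply/product_transports.
  by split; apply/line_transports.
have -> : lh (vertical (n + 1) m) = lh right.
  have h : @ale square (Vertex (n + 1), Edge m) (cell n m).
    by split; [exact: V1 | exact: E].
  apply: (morphism_leg_transports H (h := h)); apply/product_transports.
  by split; apply/line_transports.
have -> : lh (vertical n m) = lh left.
  have h : @ale square (Vertex n, Edge m) (cell n m).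
    by split; [exact: V0 | exact: E].
  apply: (morphism_leg_transports H (h := h)); apply/product_transports.
  by split; apply/line_transports.
have -> : lh (horizontal n (m + 1)) = lh top.
  have h : @ale square (Edge n, Vertex (m + 1)) (cell n m).
    by split; [exact: E | exact: V1].
  apply: (morphism_leg_transports H (h := h)); apply/product_transports.
  by split; apply/line_transports.
have br : tgt bot = src right by [].
have lt : tgt left = src top by [].
by rewrite -!morphism_leg_gmul// (gmulE br) (gmulE lt).
Qed.

(** If q n are the partial products of row m + 1, the vertical arrow at n
    followed by q n are those of row m, since the cells commute. The vertical
    arrows near both ends are identities, so the total product is the same. *)
Lemma holonomy_row_pred x y m g :
  (exists M0, forall i (f : arr (@loc square i)), (val (src f)).1 < M0 ->
    lh f = idn G (leg_obj x)) ->
  (exists M1, forall i (f : arr (@loc square i)), M1 < (val (tgt f)).1 ->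
    lh f = idn G (leg_obj y)) ->
  holonomy y (curve_arrow (morphism_comp H (row (m + 1)))) g ->
  holonomy y (curve_arrow (morphism_comp H (row m))) g.
Proof.
move=> [M0 HM0] [M1 HM1] [q [qS qT [L qL] [R qR]]].
have rowE k n : leg_arr (curve_arrow (morphism_comp H (row k)) n) =
  lh (horizontal n k) by [].
have src_q n : src (q n) = leg_obj (mset H (n, m + 1)).
  by rewrite qS src_gmul rowE src_morphism_leg.
have vq n : tgt (lh (vertical n m)) = src (q n).
  by rewrite tgt_morphism_leg src_q.
exists (fun n => gmul (lh (vertical n m)) (q n)); split.
- move=> n; rewrite rowE.
  have e1 : tgt (lh (horizontal n m)) = src (lh (vertical (n + 1) m)).
    by rewrite tgt_morphism_leg src_morphism_leg.
  have e2 : tgt (lh (vertical n m)) = src (lh (horizontal n (m + 1))).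
    by rewrite tgt_morphism_leg src_morphism_leg.
  have e3 : tgt (lh (horizontal n (m + 1))) = src (q (n + 1)).
    by rewrite tgt_morphism_leg src_q.
  rewrite (gmulA e1 (vq _)) (leg_cell n m) -(gmulA e2 e3).
  by congr gmul; exact: qS.
- by move=> n; rewrite tgt_gmul.
- exists (Num.min L M0) => n nL; rewrite HM0 /=; last by lia.
  rewrite qL; last by lia.
  rewrite idngmul// -(qL n); last by lia.
  rewrite qS src_gmul rowE HM0 ?src_idn//=; lia.
- exists (Num.max R M1) => n nR; rewrite HM1 /=; last by lia.
  by rewrite qR ?gmulidn//; lia.
Qed.

End Square.

Lemma homotopic_holonomy x y (l l' : Defs.path x y) g g' :
  homotopic l l' -> path_holonomy l g -> path_holonomy l' g' -> g = g'.
Proof.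
move=> [H [N0 [N1 [M0 [M1 [a0 [a0x [a1 [a1y [Hl Hl' HM0 HM1]]]]]]]]]].
move=> /(represents_holonomy Hl) hl /(represents_holonomy Hl') hl'.
have down m j u :
    holonomy y (curve_arrow (morphism_comp H (row (m + j%:Z)))) u ->
    holonomy y (curve_arrow (morphism_comp H (row m))) u.
  elim: j => [|j IH]; first by rewrite addr0.
  rewrite (_ : m + j.+1%:Z = m + j%:Z + 1); last by lia.
  move=> hu; apply: IH; apply: (holonomy_row_pred (x := x)) hu.
    by exists M0 => i f fM; rewrite /morphism_leg HM0// leg_local_id.
  by exists M1 => i f fM; rewrite /morphism_leg HM1// leg_local_id.
have [N01|N10] := leP N0 N1.
  apply: holonomy_inj hl _; apply: (down N0 `|N1 - N0|%N).
  by rewrite (_ : N0 + _ = N1)//; lia.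
apply: holonomy_inj hl'; apply: (down N1 `|N0 - N1|%N).
by rewrite (_ : N1 + _ = N0)//; lia.
Qed.

(** * Concatenation multiplies holonomies *)

Lemma concatenation_holonomy x y z (l : Defs.path x y) (l' : Defs.path y z)
    (m : Defs.path x z) g g' : concatenation l l' m ->
  path_holonomy l g -> path_holonomy l' g' -> path_holonomy m (gmul g g').
Proof.
move=> [lam [lam' [mu [a [a' [ay [a'y [N [k [ll ll' mm [HL HR]]]]]]]]]]].
move=> /(represents_holonomy ll)[q [qS qT [L qL] [R qR]]].
move=> /(represents_holonomy ll')[q' [qS' qT' [L' qL'] [R' qR']]].
exists mu => //.
have src_q' n : src (q' n) = leg_obj (mset lam' n).
  by rewrite qS' src_gmul (src_leg_arr A_good) lsrc_curve_arrow.
have src_q n : src (q n) = leg_obj (mset lam n).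
  by rewrite qS src_gmul (src_leg_arr A_good) lsrc_curve_arrow.
have q_end n : N <= n -> q n = idn G (leg_obj y).
  apply: (@downward_ind (fun n => N <= n -> q n = _) R) n => n.
    by move=> Rn _; exact: qR.
  move=> IH nN; rewrite qS IH; last by lia.
  by have [_ ->] := HR n nN; rewrite gmulidn leg_local_id.
have lam'y n : n < N -> mset lam' (n - k + 1) = y.
  by move=> /HL[_ e]; rewrite -ltgt_curve_arrow e ltgt_local_id.
have q'_start j : q' (N - k - j%:Z) = q' (N - k).
  elim: j => [|j <-]; first by rewrite subr0.
  rewrite (_ : N - k - j.+1%:Z = N - j.+1%:Z - k); last by lia.
  have nN : N - j.+1%:Z < N by lia.
  rewrite qS'; have [_ ->] := HL _ nN.
  rewrite leg_local_id idngmul ?src_q' ?lam'y//; congr q'; lia.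
have src_y : src (q' (N - k)) = leg_obj y.
  rewrite src_q' (_ : N - k = N - 1 - k + 1); last by lia.
  by rewrite lam'y//; lia.
have q'g : q' (N - k) = g'.
  rewrite -(q'_start `|(N - k)%R - L'|.+1); apply: qL'; lia.
(* At N the path l has already arrived and l' has not yet left, so the partial
   products of l' take over from there. *)
exists (fun n => if n < N then gmul (q n) (q' (N - k)) else q' (n - k)); split.
- move=> n; have [nN|nN] := ltP n N; last first.
    rewrite (_ : (n + 1 < N) = false); last by lia.
    by have [-> _] := HR n nN; rewrite qS'; congr (gmul _ (q' _)); lia.
  have [-> _] := HL n nN; have [n1N|n1N] := ltP (n + 1) N.
    by rewrite qS -gmulA ?qT ?(tgt_leg_arr A_good) ?src_q ?ltgt_curve_arrow.
  rewrite qS q_end// gmulidn; congr (gmul _ (q' _)); lia.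
- by move=> n; case: ifP => _ //; rewrite tgt_gmul ?qT.
- exists (Num.min N L) => n nL; rewrite (_ : (n < N) = true); last by lia.
  by rewrite qL ?q'g//; lia.
- exists (Num.max N (R' + k)) => n nR.
  by rewrite (_ : (n < N) = false); [apply: qR'|]; lia.
Qed.

Lemma trail_concatenation x y z k w (P : word x w y) k' w' (P' : word y w' z)
    (l : Defs.path x y) (l' : Defs.path y z) :
  represents (trail_curve A_good k P) (val l) ->
  represents (trail_curve A_good k' P') (val l') ->
  exists m : Defs.path x z, concatenation l l' m.
Proof.
move=> wl wl'.
have Q : word x (w ++ w') z by apply/word_cat; exists y.
exists (trail_path A_good k Q), (trail_curve A_good k P),
  (trail_curve A_good k' P'), (trail_curve A_good k Q), (initial_index y),
  (initial_index y), (initial_dom y), (initial_dom y), (k + (size w)%:Z),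
  (k + (size w)%:Z - k').
split=> //; first exact: represents_trail_path.
split=> n nN; rewrite !curve_arrow_curve_of; split.
- rewrite /trail; case: (ltP n k) => // nk.
  rewrite nth_cat (_ : (`|n - k|%N < size w)%N); last by lia.
  by apply: set_nth_default; lia.
- by rewrite trail_left//; lia.
- rewrite /trail (_ : (n < k) = false); last by lia.
  rewrite (_ : (_ < k') = false); last by lia.
  rewrite nth_cat (_ : (`|n - k|%N < size w)%N = false); last by lia.
  by congr nth; lia.
- by rewrite trail_right.
Qed.

End Holonomy.

(** * The isomorphism *)

Section TransportedGroup.
Variables (A : atlas) (x : carrier A) (V : groupType).
Variables (f : pi1 x -> V) (g : V -> pi1 x).
Hypotheses (fK : cancel f g) (gK : cancel g f).
Local Open Scope group_scope.

Let one : pi1 x := g 1.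
Let inv p : pi1 x := g (f p)^-1.
Let mul p q : pi1 x := g (f p * f q).

Let mulA : associative mul.
Proof. by move=> p q r; rewrite /mul !gK mulgA. Qed.

Let mul1 : left_id one mul.
Proof. by move=> p; rewrite /mul gK mul1g fK. Qed.

Let mulr1 : right_id one mul.
Proof. by move=> p; rewrite /mul gK mulg1 fK. Qed.

Let mulV : left_inverse one inv mul.
Proof. by move=> p; rewrite /mul gK mulVg. Qed.

Let mulrV : right_inverse one inv mul.
Proof. by move=> p; rewrite /mul gK mulgV. Qed.

Definition transported_group : pi1_law x :=
  isGroup.Build (pi1 x) mulA mul1 mulr1 mulV mulrV.

End TransportedGroup.

Section Pi1.
Variables (A : atlas) (A_good : good A) (O : Type) (G : groupoid O).
Variables (c : cocone A G) (c_colim : is_colimit c).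
Implicit Types (x y z : carrier A).

Local Notation leg_obj := (leg_obj A_good c).
Local Notation path_holonomy := (path_holonomy A_good c).

Lemma path_holonomy_ex x y (l : Defs.path x y) :
  exists g, path_holonomy l g /\ src g = leg_obj x /\ tgt g = leg_obj y.
Proof.
have [k [w [P wl]]] := path_word A_good l.
exists (eval A_good c y w); split; first exact: trail_holonomy wl.
by split; [exact: src_eval P | exact: tgt_eval P].
Qed.

Lemma holonomy_homotopic x y (l l' : Defs.path x y) g :
  path_holonomy l g -> path_holonomy l' g -> homotopic l l'.
Proof.
move=> lg l'g; have [k [w [P wl]]] := path_word A_good l.
have [k' [w' [P' wl']]] := path_word A_good l'.
apply: (word_eq_path_homotopic wl wl'); apply: (eval_inj c_colim P P').
rewrite (path_holonomy_inj (trail_holonomy c wl) lg).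
exact: path_holonomy_inj l'g (trail_holonomy c wl').
Qed.

Lemma holonomy_surj x y (g : arr G) : src g = leg_obj x -> tgt g = leg_obj y ->
  exists l : Defs.path x y, path_holonomy l g.
Proof.
move=> sg tg; have [w P <-] := eval_surj c_colim sg tg.
exists (trail_path A_good 0 P).
exact: trail_holonomy (represents_trail_path A_good 0 P).
Qed.

Lemma concatenation_ex x y z (l : Defs.path x y) (l' : Defs.path y z) :
  exists m : Defs.path x z, concatenation l l' m.
Proof.
have [k [w [P wl]]] := path_word A_good l.
have [k' [w' [P' wl']]] := path_word A_good l'.
exact: trail_concatenation wl wl'.
Qed.

(** Homotopy is the relation of having the same holonomy, so its classes are
    equivalence classes. *)
Lemma cls_homotopic x y (l l' : Defs.path x y) g :
  path_holonomy l g -> path_holonomy l' g ->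
  cls (@homotopic A x y) l = cls (@homotopic A x y) l'.
Proof.
move=> lg l'g; apply: val_inj; rewrite /= eqEsubset; split=> u /= lu.
  have [h [uh _]] := path_holonomy_ex u.
  apply: holonomy_homotopic l'g _.
  by rewrite (homotopic_holonomy lu lg uh).
have [h [uh _]] := path_holonomy_ex u.
apply: holonomy_homotopic lg _.
by rewrite (homotopic_holonomy lu l'g uh).
Qed.

(** Holonomy is a bijection from homotopy classes of loops to the vertex group
    that turns concatenation into composition; the group structure of the
    vertex group is carried over along it. *)
Lemma pi1_isomorphism x :
  exists m : pi1_law x,
    (forall p q r : pi1_group m, pi1_product p q r <-> (p * q)%g = r) /\
    exists phi : {multiplicative pi1_group m -> vertex G (leg_obj x)},
      bijective phi.
Proof.
pose hol (p : pi1 x) (g : arr G) := exists2 l, cls _ l = p & path_holonomy l g.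
have hol_ex p : exists g : vertex G (leg_obj x), hol p (val g).
  have [l lp] := cls_surj p; have [g [lg gx]] := path_holonomy_ex l.
  by exists (vertex_elt gx), l.
have hol_inj p g g' : hol p g -> hol p g' -> g = g'.
  move=> [l <- lg] [l' ll' l'g]; apply: homotopic_holonomy _ lg l'g.
  have : val (cls (@homotopic A x x) l') l'.
    have [h [l'h _]] := path_holonomy_ex l'.
    exact: (holonomy_homotopic l'h l'h).
  by rewrite ll'.
have cls_inj p p' g : hol p g -> hol p' g -> p = p'.
  by move=> [l <- lg] [l' <- l'g]; exact: cls_homotopic lg l'g.
have hol_surj (g : vertex G (leg_obj x)) : exists p, hol p (val g).
  have [sg tg] := vertexP g; have [l lg] := holonomy_surj sg tg.
  by exists (cls _ l), l.
pose f p := sval (cid (hol_ex p)); pose e g := sval (cid (hol_surj g)).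
have fP p : hol p (val (f p)) by exact: svalP (cid (hol_ex p)).
have eP g : hol (e g) (val g) by exact: svalP (cid (hol_surj g)).
have fK : cancel f e by move=> p; apply: cls_inj (eP _) (fP _).
have eK : cancel e f by move=> g; apply: val_inj; apply: hol_inj (fP _) (eP _).
have prodE p q r : pi1_product p q r <-> (f p * f q)%g = f r.
  have mulE : val (f p * f q)%g = gmul (val (f p)) (val (f q)).
    exact: esym (gmulE (vertex_composable (f p) (f q))).
  split=> [[l [l' [m [pl ql rm lm]]]]|fpq].
    have [g [lg _]] := path_holonomy_ex l.
    have [h [lh _]] := path_holonomy_ex l'.
    apply: val_inj; rewrite mulE.
    rewrite (hol_inj p _ g (fP p)); last by exists l.
    rewrite (hol_inj q _ h (fP q)); last by exists l'.
    apply: (hol_inj r) (fP r); exists m => //.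
    exact: concatenation_holonomy lm lg lh.
  have [[l lp lg] [l' lq lh]] := (fP p, fP q).
  have [m lm] := concatenation_ex l l'; exists l, l', m; split=> //.
  apply: (cls_inj _ _ (val (f r))) => //; exists m => //.
  rewrite -fpq mulE; exact: concatenation_holonomy lm lg lh.
exists (transported_group fK eK); split=> [p q r|].
  rewrite prodE; split=> [E|<-]; last by rewrite eK.
  by apply: (etrans (congr1 e E)); exact: fK.
have fM : {morph (f : pi1_group (transported_group fK eK) -> _) :
    p q / (p * q)%g}.
  by move=> p q; exact: eK.
pose F := isMultiplicative.Build _ _ _ fM.
exists (HB.pack_for {multiplicative pi1_group (transported_group fK eK) ->
  vertex G (leg_obj x)} (f : pi1_group (transported_group fK eK) -> _) F).
by exists e.
Qed.

End Pi1.

Theorem theorem4p3p4 (A : atlas) (A_irr : irreducible A) (A_good : good A)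
  (x : carrier A) (O : Type) (G : groupoid O) (c : cocone A G)
  (c_colim : is_colimit c) (a : aidx A) (ax : dom a x) :
  exists m : pi1_law x,
    (forall p q r : pi1_group m, pi1_product p q r <-> (p * q)%g = r) /\
    exists phi : {multiplicative pi1_group m ->
                                 vertex G (fobj (leg c a) (elt ax))},
      bijective phi.
Proof.
by rewrite (fobj_leg A_good); exact: pi1_isomorphism.
Qed.
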